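(* Let $\tilde M_k=\mathrm{Im}\,\pi_k\subseteq M_k$. Then: (1) $\tilde M_k=\mathrm{Im}\,\pi_k=\mathrm{Eq}\left(\overleftarrow{p}_k,\overrightarrow{p}_k\right)=\ker\left(\overleftarrow{p}_k-\overrightarrow{p}_k\right)$. (2) $\mathrm{coker}\left(\overleftarrow{p}_k-\overrightarrow{p}_k\right)\cong\mathbb Z/2\mathbb Z$; i.e. $\mathrm{rank}\,\tilde M_k=\mathrm{rank}\ker\left(\overleftarrow{p}_k-\overrightarrow{p}_k\right)=\mathrm{rank}\,M_k-\mathrm{rank}\,M_{k-1}=n(2n-2)(2n-1)^{k-2}$. (3) Let $p_k=\overleftarrow{p}_k|_{\tilde M_k}=\overrightarrow{p}_k|_{\tilde M_k}$. Then $p_k\circ\pi_k=\pi_{k-1}$.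
   Context: Let $F_n$ be a free group with basis $X$, $|X|=n$. Graphs are in the sense of Serre (edges come with a fixed-point-free inversion $e\mapsto\bar e$). An $X$-labeled graph has edges labeled by $X\cup X^{-1}$ so that $\bar e$ carries the inverse label; morphisms preserve labels; it is folded if distinct edges with the same initial vertex have distinct labels. A u-word (unoriented word) is a folded labeled graph homeomorphic to a compact line segment, up to isomorphism (equivalently, a reduced word $u\neq1$ up to inversion, $\overline u=\overline{u^{-1}}$; $u$ and $u^{-1}$ are its orientations); its length is its number of unoriented edges. A cyclic word is a folded labeled graph homeomorphic to a circle, up to isomorphism (equivalently, a nontrivial cyclically reduced word up to cyclic permutation and inversion). $\mathrm{Hom}(u,w)$ is the set of labeled graph morphisms $u\to w$ (not necessarily injective). $W_k$ is the set of u-words of length $k$, $M_k$ is the free $\mathbb Z$-module on $W_k$, $C$ is the set of cyclic words and $\mathbb Z[C]$ is the free $\mathbb Z$-module on $C$. The homomorphism $\pi_k:\mathbb Z[C]\to M_k$ is defined by $\pi_k(w)=\sum_{u\in W_k}|\mathrm{Hom}(u,w)|\,u$ for $w\in C$. Fix an arbitrary choice of orientation for every u-word. For a u-word $\overline w$ of length $>j$, its two $j$-affixes are the u-words of length $j$ given by the length-$j$ prefix and the length-$j$ suffix of an orientation $w$. If $\overline u$ is a $j$-affix of $\overline w$ and $u$ is the chosen orientation of $\overline u$, then $\overline u$ points inward in $\overline w$ if $u$ is a prefix of $w$ or $u^{-1}$ is a suffix of $w$, and points outward if $u^{-1}$ is a prefix of $w$ or $u$ is a suffix of $w$. For $k\ge2$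 (so that $M_{k-1}$ is defined), define $\overleftarrow{p}_k,\overrightarrow{p}_k:M_k\to M_{k-1}$ on $w\in W_k$ by $\overleftarrow p_k(w)=\sum_{u\in W_{k-1}}\overleftarrow\delta_u(w)\,u$ and $\overrightarrow p_k(w)=\sum_{u\in W_{k-1}}\overrightarrow\delta_u(w)\,u$, where $\overleftarrow\delta_u(w)=1$ if $u$ is a $(k-1)$-affix of $w$ pointing outward and $0$ otherwise, and $\overrightarrow\delta_u(w)=1$ if $u$ is a $(k-1)$-affix of $w$ pointing inward and $0$ otherwise. $\mathrm{Eq}$ denotes the equalizer.
   Formalization: Part (2) is proved only for n ≥ 2, since it is false otherwise: for n = 1 the two maps coincide, so the cokernel is Z and the kernel has rank 1 instead of 0; for n = 0 all modules and the cokernel are 0. Parts (1) and (3) hold for all n. *)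

(* Defs.v *)
From HB Require Import structures.
From mathcomp Require Import all_boot all_order all_algebra.
From mathcomp Require Import boolp.
From mathcomp Require Import freeg.
Import GRing.Theory.

Set Implicit Arguments.
Unset Strict Implicit.
Unset Printing Implicit Defensive.

Local Open Scope ring_scope.
Local Open Scope quotient_scope.

(* (x, true) is the letter x, (x, false) is the letter x^-1. *)
Definition letter (X : finType) : finType := (X * bool)%type.

Definition linv (X : finType) (a : letter X) : letter X := (a.1, ~~ a.2).

Definition winv (X : finType) (s : seq (letter X)) : seq (letter X) :=
  rev (map (@linv X) s).

Definition noncancel (X : finType) : rel (letter X) :=
  fun a b => b != linv a.

Definition word_reduced (X : finType) (s : seq (letter X)) : bool :=
  (s != [::]) && sorted (@noncancel X) s.

Definition word_cyc_reduced (X : finType) (s : seq (letter X)) : bool :=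
  (s != [::]) && cycle (@noncancel X) s.

Section WordFacts.
Variable X : finType.
Implicit Types (a b : letter X) (s t : seq (letter X)).

Lemma linvK : involutive (@linv X).
Proof. by case=> x b; rewrite /linv negbK. Qed.

Lemma linv_neq a : linv a != a.
Proof. by apply/eqP => /(congr1 snd) /=; case: (a.2). Qed.

Lemma noncancel_inv a b : noncancel (linv b) (linv a) = noncancel a b.
Proof.
rewrite /noncancel linvK. by rewrite eq_sym. Qed.

Lemma winvK : involutive (@winv X).
Proof. by move=> s; rewrite /winv map_rev revK mapK //; exact: linvK. Qed.

Lemma size_winv s : size (winv s) = size s.
Proof. by rewrite size_rev size_map. Qed.

Lemma winv_eq0 s : (winv s == [::]) = (s == [::]).
Proof. by rewrite -!size_eq0 size_winv. Qed.

Lemma word_reduced_inv s : word_reduced (winv s) = word_reduced s.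
Proof.
rewrite /word_reduced winv_eq0 rev_sorted sorted_map; congr (_ && _).
by apply: eq_sorted => a b; exact: noncancel_inv.
Qed.

Lemma word_cyc_reduced_inv s : word_cyc_reduced (winv s) = word_cyc_reduced s.
Proof.
rewrite /word_cyc_reduced winv_eq0 rev_cycle cycle_map; congr (_ && _).
by apply: eq_cycle => a b; exact: noncancel_inv.
Qed.

Lemma winv_rot i s : (i <= size s)%N -> winv (rot i s) = rot (size s - i) (winv s).
Proof.
by move=> le_i; rewrite /winv map_rot rev_rot /rotr size_rev size_map.
Qed.

Lemma word_cyc_reduced_rot i s : word_cyc_reduced (rot i s) = word_cyc_reduced s.
Proof. by rewrite /word_cyc_reduced -!size_eq0 size_rot rot_cycle. Qed.

End WordFacts.

(* Finite graphs in the sense of Serre: the terminal vertex of e is           *)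
(* lg_src (lg_bar e).                                                         *)
Record lgraph (X : finType) := LGraph {
  lg_vert : finType;
  lg_edge : finType;
  lg_src : lg_edge -> lg_vert;
  lg_bar : lg_edge -> lg_edge;
  lg_lab : lg_edge -> letter X;
  lg_barK : involutive lg_bar;
  lg_bar_neq : forall e, lg_bar e != e;
  lg_lab_bar : forall e, lg_lab (lg_bar e) = linv (lg_lab e)
}.
Arguments lg_src {X l} _.
Arguments lg_bar {X l} _.
Arguments lg_lab {X l} _.

Definition lg_folded (X : finType) (G : lgraph X) : Prop :=
  forall e e' : lg_edge G, lg_src e = lg_src e' -> lg_lab e = lg_lab e' -> e = e'.

Definition lg_maps (X : finType) (G H : lgraph X) : finType :=
  ({ffun lg_vert G -> lg_vert H} * {ffun lg_edge G -> lg_edge H})%type.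

Definition lg_is_hom (X : finType) (G H : lgraph X) (f : lg_maps G H) : bool :=
  [forall e : lg_edge G,
    [&& f.1 (lg_src e) == lg_src (f.2 e),
        f.2 (lg_bar e) == lg_bar (f.2 e)
      & lg_lab (f.2 e) == lg_lab e]].

Definition lg_hom (X : finType) (G H : lgraph X) : {set lg_maps G H} :=
  [set f | lg_is_hom f].

Definition lg_iso (X : finType) (G H : lgraph X) : Prop :=
  exists2 f : lg_maps G H, lg_is_hom f & bijective f.1 /\ bijective f.2.

Section SegmentCircle.
Variables (X : finType) (s : seq (letter X)).

(* The edge (i, true) reads the i-th letter of s forwards, and (i, false) is  *)
(* its inverse edge.                                                          *)
Definition pos_bar (e : 'I_(size s) * bool) := (e.1, ~~ e.2).
Definition pos_lab (e : 'I_(size s) * bool) : letter X :=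
  if e.2 then tnth (in_tuple s) e.1 else linv (tnth (in_tuple s) e.1).

Lemma pos_barK : involutive pos_bar.
Proof. by case=> i b; rewrite /pos_bar negbK. Qed.

Lemma pos_bar_neq e : pos_bar e != e.
Proof. by apply/eqP => /(congr1 snd) /=; case: (e.2). Qed.

Lemma pos_lab_bar e : pos_lab (pos_bar e) = linv (pos_lab e).
Proof. by case: e => i []; rewrite /pos_lab //= linvK. Qed.

Definition segment_src (e : 'I_(size s) * bool) : 'I_(size s).+1 :=
  if e.2 then widen_ord (leqnSn _) e.1 else fintype.lift ord0 e.1.

(* ordS is the successor modulo size s. *)
Definition circle_src (e : 'I_(size s) * bool) : 'I_(size s) :=
  if e.2 then e.1 else ordS e.1.

Definition segment : lgraph X :=
  LGraph segment_src pos_barK pos_bar_neq pos_lab_bar.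

Definition circle : lgraph X :=
  LGraph circle_src pos_barK pos_bar_neq pos_lab_bar.

End SegmentCircle.

Definition rword (X : finType) (k : nat) : Type :=
  {w : k.-tuple (letter X) | word_reduced w}.

HB.instance Definition _ (X : finType) (k : nat) := SubFinite.on (rword X k).

Definition rword_seq (X : finType) (k : nat) (w : rword X k) : seq (letter X) :=
  val (val w).
Coercion rword_seq : rword >-> seq.

Section UWord.
Variables (X : finType) (k : nat).

Definition uword_equiv : rel (rword X k) :=
  fun v w => (v == w :> seq _) || (v == winv w :> seq _).

Lemma uword_equiv_refl : reflexive uword_equiv.
Proof. by move=> v; rewrite /uword_equiv eqxx. Qed.

Lemma uword_equiv_sym : symmetric uword_equiv.
Proof.
move=> v w; rewrite /uword_equiv eq_sym; congr (_ || _).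
by rewrite -(inj_eq (can_inj (@winvK X))) winvK eq_sym.
Qed.

Lemma uword_equiv_trans : transitive uword_equiv.
Proof.
rewrite /uword_equiv => v u w /orP[] /eqP -> // /orP[] /eqP ->; rewrite ?winvK eqxx //.
by rewrite orbT.
Qed.

Canonical uword_equiv_rel :=
  EquivRel uword_equiv uword_equiv_refl uword_equiv_sym uword_equiv_trans.

(* W_k. The orientations of u : uword X k are the w with \pi w = u. *)
Definition uword := {eq_quot uword_equiv}.

HB.instance Definition _ : EqQuotient _ uword_equiv uword := EqQuotient.on uword.
HB.instance Definition _ := Countable.on uword.
HB.instance Definition _ : isFinite uword := CanIsFinite (@reprK _ uword).

End UWord.

Definition cycred (X : finType) : Type :=
  {s : seq (letter X) | word_cyc_reduced s}.

HB.instance Definition _ (X : finType) := SubChoice.on (cycred X).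

Definition cycred_seq (X : finType) (s : cycred X) : seq (letter X) := val s.
Coercion cycred_seq : cycred >-> seq.

Section CWord.
Variable X : finType.

Definition cword_equiv : rel (cycred X) :=
  fun s t => [exists i : 'I_(size t),
    (s == rot i t :> seq _) || (s == rot i (winv t) :> seq _)].

Lemma cword_equivP (s t : cycred X) :
  reflect (exists i, s = rot i t :> seq _ \/ s = rot i (winv t) :> seq _)
          (cword_equiv s t).
Proof.
have t_gt0 : (0 < size t)%N.
  by case: t => -[|a t] //=.
apply: (iffP existsP) => [[i /orP[] /eqP E] | [i E]]; first by exists i; left.
  by exists i; right.
have [lt_i|le_i] := ltnP i (size t).
  by exists (Ordinal lt_i); case: E => ->; rewrite eqxx ?orbT.
exists (Ordinal t_gt0); rewrite !rot0.
by case: E => ->; rewrite rot_oversize ?size_winv // eqxx ?orbT.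
Qed.

Lemma cword_equiv_refl : reflexive cword_equiv.
Proof. by move=> s; apply/cword_equivP; exists 0%N; left; rewrite rot0. Qed.

Lemma cword_equiv_subsym (s t : cycred X) : cword_equiv s t -> cword_equiv t s.
Proof.
move=> /existsP[i /orP[] /eqP E]; apply/cword_equivP.
  by exists (size s - i)%N; left; rewrite -[LHS](rotK i) /rotr E.
exists i; right; rewrite E winv_rot ?size_winv ?winvK; last exact: ltnW.
by rewrite -rotD ?subnKC ?rot_size //= ltnW.
Qed.

Lemma cword_equiv_sym : symmetric cword_equiv.
Proof. by move=> s t; apply/idP/idP; exact: cword_equiv_subsym. Qed.

Lemma cword_equiv_trans : transitive cword_equiv.
Proof.
move=> t s u /cword_equivP[i Ei] /existsP[j /orP Ej]; apply/cword_equivP.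
have le_j := ltnW (ltn_ord j).
case: Ej Ei => /eqP-> [] ->.
- by rewrite rot_rot_add; eexists; left.
- by rewrite winv_rot // rot_rot_add; eexists; right.
- by rewrite rot_rot_add; eexists; right.
- by rewrite winv_rot ?size_winv // winvK rot_rot_add; eexists; left.
Qed.

Canonical cword_equiv_rel :=
  EquivRel cword_equiv cword_equiv_refl cword_equiv_sym cword_equiv_trans.

Definition cword := {eq_quot cword_equiv}.

HB.instance Definition _ : EqQuotient _ cword_equiv cword := EqQuotient.on cword.
HB.instance Definition _ := Choice.on cword.

End CWord.

(* Up to lg_iso these do not depend on the representative picked by repr: see *)
(* uword_graph_pi and cword_graph_pi. By segment_folded and circle_folded,    *)
(* (cyclically) reduced words are those whose graph is folded.                *)
Definition uword_graph (X : finType) (k : nat) (u : uword X k) : lgraph X :=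
  segment (repr u).

Definition cword_graph (X : finType) (c : cword X) : lgraph X :=
  circle (repr c).

Section IsoFacts.
Variable X : finType.
Implicit Types (G H K : lgraph X) (s t : seq (letter X)).

Lemma lg_homP G H (f : lg_maps G H) :
  reflect (forall e, [/\ f.1 (lg_src e) = lg_src (f.2 e),
                         f.2 (lg_bar e) = lg_bar (f.2 e)
                       & lg_lab (f.2 e) = lg_lab e])
          (lg_is_hom f).
Proof.
apply: (iffP forallP) => h e; have := h e.
  by case/and3P => /eqP-> /eqP-> /eqP->.
by case=> -> -> ->; rewrite !eqxx.
Qed.

Lemma lg_isoI G H (f : lg_vert G -> lg_vert H) (g : lg_edge G -> lg_edge H) :
  bijective f -> bijective g ->
  (forall e, f (lg_src e) = lg_src (g e)) ->
  (forall e, g (lg_bar e) = lg_bar (g e)) ->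
  (forall e, lg_lab (g e) = lg_lab e) -> lg_iso G H.
Proof.
move=> bf bg h1 h2 h3; exists (finfun f, finfun g).
  by apply/lg_homP => e /=; rewrite !ffunE; split.
by split; [apply: (eq_bij bf) | apply: (eq_bij bg)] => x; rewrite ffunE.
Qed.

Lemma lg_iso_refl G : lg_iso G G.
Proof. by apply: (@lg_isoI G G id id) => //; exists id. Qed.

Lemma lg_iso_sym G H : lg_iso G H -> lg_iso H G.
Proof.
case=> f /lg_homP hf [[g1 f1K g1K] [g2 f2K g2K]].
apply: (@lg_isoI H G g1 g2); [by exists f.1 | by exists f.2 | move=> e..].
- by apply: (can_inj f1K); rewrite g1K; have [-> _ _] := hf (g2 e); rewrite g2K.
- by apply: (can_inj f2K); rewrite g2K; have [_ -> _] := hf (g2 e); rewrite g2K.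
- by have [_ _ <-] := hf (g2 e); rewrite g2K.
Qed.

Definition lg_comp G H K (g : lg_maps H K) (f : lg_maps G H) : lg_maps G K :=
  ([ffun x => g.1 (f.1 x)], [ffun e => g.2 (f.2 e)]).

Lemma lg_comp_hom G H K (g : lg_maps H K) (f : lg_maps G H) :
  lg_is_hom g -> lg_is_hom f -> lg_is_hom (lg_comp g f).
Proof.
move=> /lg_homP hg /lg_homP hf; apply/lg_homP => e /=; rewrite !ffunE.
have [-> -> <-] := hf e; have [-> -> ->] := hg (f.2 e); by [].
Qed.

Lemma lg_iso_trans G H K : lg_iso G H -> lg_iso H K -> lg_iso G K.
Proof.
case=> f hf [b1 b2] [g hg [c1 c2]]; exists (lg_comp g f).
  exact: lg_comp_hom.
split; [apply: (eq_bij (bij_comp c1 b1))|apply: (eq_bij (bij_comp c2 b2))];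
  by move=> x /=; rewrite ffunE.
Qed.

Lemma leq_card_lg_hom G G' H H' :
  lg_iso G G' -> lg_iso H H' -> (#|lg_hom G H| <= #|lg_hom G' H'|)%N.
Proof.
move=> iG [g hg [[g1 g1K _] [g2 g2K _]]].
have [f hf [[f1 _ f1K] [f2 _ f2K]]] := lg_iso_sym iG.
pose F h := lg_comp g (lg_comp h f).
rewrite -(@card_in_imset _ _ F); last first.
  move=> [h1 h2] [k1 k2] _ _ [/ffunP E1 /ffunP E2]; congr (_, _); apply/ffunP => x.
    by have := E1 (f1 x); rewrite !ffunE /= f1K => /(can_inj g1K).
  by have := E2 (f2 x); rewrite !ffunE /= f2K => /(can_inj g2K).
apply/subset_leq_card/subsetP => x /imsetP[h hh ->]; move: hh; rewrite !inE => hh.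
by apply: lg_comp_hom => //; apply: lg_comp_hom.
Qed.

Lemma card_lg_hom_iso G G' H H' :
  lg_iso G G' -> lg_iso H H' -> #|lg_hom G H| = #|lg_hom G' H'|.
Proof.
move=> iG iH; apply/eqP; rewrite eqn_leq !leq_card_lg_hom //; exact: lg_iso_sym.
Qed.

Lemma tnth_winv s (i : 'I_(size s)) (j : 'I_(size (winv s))) :
  j = rev_ord i :> nat -> tnth (in_tuple (winv s)) j = linv (tnth (in_tuple s) i).
Proof.
move=> Ej; have x0 := tnth (in_tuple s) i.
rewrite !(tnth_nth x0) /= /winv nth_rev ?size_map ?Ej ?rev_ord_proof //=.
rewrite subnS subKn; last exact: ltn_ord.
by rewrite (nth_map x0) ?ltn_ord.
Qed.

Lemma segment_iso_inv s : lg_iso (segment s) (segment (winv s)).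
Proof.
have E : size s = size (winv s) by rewrite size_winv.
have ES : (size s).+1 = (size (winv s)).+1 by rewrite -E.
apply: (@lg_isoI (segment s) (segment (winv s))
  (fun i => cast_ord ES (rev_ord i))
  (fun e => (cast_ord E (rev_ord e.1), ~~ e.2))).
- exists (fun i => rev_ord (cast_ord (esym ES) i)) => i.
    by rewrite cast_ordK rev_ordK.
  by rewrite rev_ordK cast_ordKV.
- exists (fun e => (rev_ord (cast_ord (esym E) e.1), ~~ e.2)) => -[i b] /=.
    by rewrite cast_ordK rev_ordK negbK.
  by rewrite rev_ordK cast_ordKV negbK.
- case=> i [] /=; apply: val_inj; rewrite /segment_src /= /bump /=.
    by rewrite subSS add1n -subSn // ltn_ord.
  by rewrite subSS add1n.
- by [].
- by case=> i [] /=; rewrite /pos_lab /= (tnth_winv (i := i)) ?linvK.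
Qed.

Lemma circle_iso_rot1 s : lg_iso (circle (rot 1 s)) (circle s).
Proof.
have E : size (rot 1 s) = size s by rewrite size_rot.
have oE (i : 'I_(size (rot 1 s))) : ordS (cast_ord E i) = cast_ord E (ordS i).
  by apply: val_inj; congr (_ %% _)%N.
apply: (@lg_isoI (circle (rot 1 s)) (circle s)
  (fun i => ordS (cast_ord E i))
  (fun e => (ordS (cast_ord E e.1), e.2))).
- exists (fun i => cast_ord (esym E) (ord_pred i)) => i.
    by rewrite ordSK cast_ordK.
  by rewrite cast_ordKV ord_predK.
- exists (fun e => (cast_ord (esym E) (ord_pred e.1), e.2)) => -[i b] /=.
    by rewrite ordSK cast_ordK.
  by rewrite cast_ordKV ord_predK.
- by case=> i [] /=; rewrite /circle_src //= -oE.
- by [].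
move=> [i b]; rewrite /= /pos_lab /=.
suff -> : tnth (in_tuple s) (ordS (cast_ord E i)) = tnth (in_tuple (rot 1 s)) i by [].
have x0 : letter X := tnth (in_tuple s) (cast_ord E i).
rewrite !(tnth_nth x0) /= {oE}.
case: i => i /= lt_i in x0 *; case: s E lt_i x0 => [|x s] // E.
rewrite rot1_cons size_rcons /= => lt_i x0; rewrite nth_rcons.
have [lt_s|] := ltnP i (size s); first by rewrite modn_small.
rewrite leq_eqVlt ltnNge -ltnS lt_i orbF => /eqP <-.
by rewrite modnn eqxx.
Qed.

Lemma circle_iso_rot i s : lg_iso (circle (rot i s)) (circle s).
Proof.
elim: i => [|i IH]; first by rewrite rot0; exact: lg_iso_refl.
have [lt_i|le_i] := ltnP i (size s); last first.
  by rewrite rot_oversize; [exact: lg_iso_refl | exact: leqW].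
by rewrite rotS //; apply: lg_iso_trans IH; exact: circle_iso_rot1.
Qed.

Lemma circle_iso_inv s : lg_iso (circle s) (circle (winv s)).
Proof.
have E : size s = size (winv s) by rewrite size_winv.
have ordSE (i : 'I_(size s)) : ordS (cast_ord E i) = cast_ord E (ordS i).
  by apply: val_inj; congr (_ %% _)%N.
have revS (i : 'I_(size s)) : ordS (rev_ord (ordS i)) = rev_ord i.
  apply: val_inj => /=; case: (size s) i => [[]//|m] i /=.
  have [lt_i|] := ltnP i m; first by rewrite [(i.+1 %% _)%N]modn_small // !subSS subnSK // modn_small // ltnS leq_subr.
  move=> le_m; have -> : i = m :> nat by apply/eqP; rewrite eqn_leq le_m -ltnS ltn_ord.
  by rewrite modnn subn1 /= modnn subnn.
apply: (@lg_isoI (circle s) (circle (winv s))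
  (fun i => cast_ord E (ordS (rev_ord i)))
  (fun e => (cast_ord E (rev_ord e.1), ~~ e.2))).
- exists (fun i => rev_ord (ord_pred (cast_ord (esym E) i))) => i.
    by rewrite cast_ordK ordSK rev_ordK.
  by rewrite rev_ordK ord_predK cast_ordKV.
- exists (fun e => (rev_ord (cast_ord (esym E) e.1), ~~ e.2)) => -[i b] /=.
    by rewrite cast_ordK rev_ordK negbK.
  by rewrite rev_ordK cast_ordKV negbK.
- by case=> i [] /=; rewrite /circle_src /= ?ordSE ?revS.
- by [].
- by case=> i [] /=; rewrite /pos_lab /= (tnth_winv (i := i)) ?linvK.
Qed.

Lemma uword_graph_pi k (w : rword X k) :
  lg_iso (uword_graph (\pi_(uword X k) w)) (segment w).
Proof.
rewrite /uword_graph; case: piP => v /eqmodP/orP[] /eqP.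
  by move=> ->; exact: lg_iso_refl.
by move=> ->; exact: segment_iso_inv.
Qed.

Lemma cword_graph_pi (s : cycred X) :
  lg_iso (cword_graph (\pi_(cword X) s)) (circle s).
Proof.
rewrite /cword_graph; case: piP => t /eqmodP/cword_equivP[i [] ->].
  exact/lg_iso_sym/circle_iso_rot.
by apply: lg_iso_trans (circle_iso_inv _) _; exact/lg_iso_sym/circle_iso_rot.
Qed.

Lemma segment_folded s :
  s != [::] -> lg_folded (segment s) <-> word_reduced s.
Proof.
rewrite /word_reduced => s0; rewrite s0 /=.
have [x0 _] : exists x0, x0 \in s.
  by case: s s0 => // x s _; exists x; rewrite inE eqxx.
split=> [fold | /(sortedP x0) red].
  apply/(sortedP x0) => i lt_i; apply/eqP => E.
  have /= := fold (Ordinal lt_i, true) (Ordinal (ltnW lt_i), false).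
  rewrite /pos_lab /= !(tnth_nth x0) /= => /(_ _ E) F.
  have /F/(congr1 snd) // : segment_src (Ordinal lt_i, true) =
    segment_src (Ordinal (ltnW lt_i), false) by exact: val_inj.
have no i i' : ~ (segment_src (i, true) = segment_src (s := s) (i', false) /\
    pos_lab (i, true) = pos_lab (i', false)).
  case=> /(congr1 val) /= Ei; rewrite /pos_lab /= !(tnth_nth x0) /= Ei => E.
  have /= := red i'; rewrite /noncancel E eqxx => /implyP; rewrite implybF.
  by have := ltn_ord i; rewrite Ei => ->.
case=> i [] [i' []] /= E1 E2.
- by congr (_, _); apply: val_inj; have := congr1 val E1.
- by case: (no i i').
- by case: (no i' i).
- by congr (_, _); apply: (lift_inj E1).
Qed.

Lemma circle_folded s :
  s != [::] -> lg_folded (circle s) <-> word_cyc_reduced s.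
Proof.
rewrite /word_cyc_reduced => s0; rewrite s0 /=.
have [x0 _] : exists x0, x0 \in s.
  by case: s s0 => // x s _; exists x; rewrite inE eqxx.
have cycP : cycle (@noncancel X) s <->
    forall i : 'I_(size s), noncancel (nth x0 s i) (nth x0 s (ordS i)).
  case: s s0 => // x s _ /=; split=> [/(pathP x0) h i|h].
    have := h i; rewrite size_rcons => /(_ (ltn_ord i)).
    have -> : nth x0 (x :: rcons s x) i = nth x0 (x :: s) i.
      by case: i => -[|i] //= lt_i; rewrite nth_rcons -ltnS lt_i.
    have -> // : nth x0 (rcons s x) i = nth x0 (x :: s) (i.+1 %% (size s).+1).
    rewrite nth_rcons; have [lt_i|le_i] := ltnP i (size s).
      by rewrite modn_small.
    have -> : i = size s :> nat by apply/eqP; rewrite eqn_leq le_i -ltnS ltn_ord.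
    by rewrite eqxx modnn.
  apply/(pathP x0) => i; rewrite size_rcons => lt_i.
  have := h (Ordinal lt_i) => /=.
  have -> : nth x0 (x :: rcons s x) i = nth x0 (x :: s) i.
    by case: i lt_i => [|i] //= lt_i; rewrite nth_rcons -ltnS lt_i.
  have -> // : nth x0 (rcons s x) i = nth x0 (x :: s) (i.+1 %% (size s).+1).
  rewrite nth_rcons; have [lt_s|le_i] := ltnP i (size s).
    by rewrite modn_small.
  have -> : i = size s :> nat by apply/eqP; rewrite eqn_leq le_i -ltnS lt_i.
  by rewrite eqxx modnn.
rewrite cycP; split=> [fold i | red].
  apply/eqP => E; have := fold (ordS i, true) (i, false) erefl.
  rewrite /= /pos_lab /= !(tnth_nth x0) => /(_ E).
  by move/(congr1 snd).
have no i i' : ~ (circle_src (i, true) = circle_src (s := s) (i', false) /\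
    pos_lab (i, true) = pos_lab (i', false)).
  case; rewrite /circle_src /= => ->; rewrite /pos_lab /= !(tnth_nth x0) => E.
  by have := red i'; rewrite /noncancel -E eqxx.
case=> i [] [i' []] /= E1 E2.
- by congr (_, _).
- by case: (no i i').
- by case: (no i' i).
- by congr (_, _); apply: (can_inj (@ordSK _)).
Qed.

End IsoFacts.

Notation ZC X := {freeg (cword X) / int}.
Notation M X k := {freeg (uword X k) / int}.

Definition hom_count (X : finType) (k : nat) (u : uword X k) (c : cword X) : nat :=
  #|lg_hom (uword_graph u) (cword_graph c)|.

Definition pi_gen (X : finType) (k : nat) (c : cword X) : M X k :=
  \sum_(u : uword X k) << (hom_count u c)%:Z *g u >>.

Definition pi_map (X : finType) (k : nat) : ZC X -> M X k :=
  fglift (@pi_gen X k).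

HB.instance Definition _ (X : finType) (k : nat) :=
  GRing.isZmodMorphism.Build _ _ (@pi_map X k) (lift_is_additive (@pi_gen X k)).

Section Affix.
Variables (X : finType) (j k : nat).

Definition affix (u : uword X j) (w : uword X k) : bool :=
  [exists v : rword X j, [exists x : rword X k,
    [&& \pi_(uword X j) v == u, \pi_(uword X k) x == w
      & prefix v x || suffix v x]]].

(* o u is the chosen orientation of u; both disjunctions below are unchanged  *)
(* when the orientation x of w is replaced by its inverse.                    *)
Variable o : uword X j -> rword X j.

Definition points_inward (u : uword X j) (w : uword X k) : bool :=
  [exists x : rword X k, (\pi_(uword X k) x == w) &&
    (prefix (o u) x || suffix (winv (o u)) x)].

Definition points_outward (u : uword X j) (w : uword X k) : bool :=
  [exists x : rword X k, (\pi_(uword X k) x == w) &&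
    (prefix (winv (o u)) x || suffix (o u) x)].

End Affix.

Section PMaps.
Variables (X : finType) (o : forall j, uword X j -> rword X j) (k : nat).

Definition delta_left (u : uword X k.-1) (w : uword X k) : nat :=
  affix u w && points_outward (@o k.-1) u w.

Definition delta_right (u : uword X k.-1) (w : uword X k) : nat :=
  affix u w && points_inward (@o k.-1) u w.

Definition pleft_gen (w : uword X k) : M X k.-1 :=
  \sum_(u : uword X k.-1) << (delta_left u w)%:Z *g u >>.

Definition pright_gen (w : uword X k) : M X k.-1 :=
  \sum_(u : uword X k.-1) << (delta_right u w)%:Z *g u >>.

Definition pleft : M X k -> M X k.-1 := fglift pleft_gen.
Definition pright : M X k -> M X k.-1 := fglift pright_gen.

HB.instance Definition _ := 
  GRing.isZmodMorphism.Build _ _ pleft (lift_is_additive pleft_gen).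
HB.instance Definition _ := 
  GRing.isZmodMorphism.Build _ _ pright (lift_is_additive pright_gen).

End PMaps.

Definition im (A B : zmodType) (f : A -> B) : {pred B} :=
  fun y => `[< exists x, f x = y >].

Definition equalizer (A B : zmodType) (f g : A -> B) : {pred A} :=
  fun x => f x == g x.

Definition ker (A B : zmodType) (f : A -> B) : {pred A} := fun x => f x == 0.

Section Coker.
Variables (A B : zmodType) (f : {additive A -> B}).

Lemma im_zmod_closed : zmod_closed (im f).
Proof.
split=> [|x y /asboolP[a <-] /asboolP[b <-]]; apply/asboolP.
  by exists 0; rewrite raddf0.
by exists (a - b); rewrite raddfB.
Qed.

HB.instance Definition _ := GRing.isZmodClosed.Build B (im f) im_zmod_closed.

Definition coker := Quotient.quot (im f).
HB.instance Definition _ := GRing.Zmodule.on coker.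

End Coker.

Definition Zfree (A : zmodType) (r : nat) (s : r.-tuple A) : Prop :=
  forall c : 'I_r -> int, \sum_(i < r) tnth s i *~ c i = 0 -> forall i, c i = 0.

Definition has_rank (A : zmodType) (S : {pred A}) (r : nat) : Prop :=
  (exists2 s : r.-tuple A, {subset s <= S} & Zfree s) /\
  (forall (r' : nat) (s : r'.-tuple A), {subset s <= S} -> Zfree s -> (r' <= r)%N).

Definition Mtilde (X : finType) (k : nat) := {m : M X k | m \in im (@pi_map X k)}.

Lemma pi_map_im (X : finType) (k : nat) (z : ZC X) :
  @pi_map X k z \in im (@pi_map X k).
Proof. by apply/asboolP; exists z. Qed.

Definition pi_tilde (X : finType) (k : nat) (z : ZC X) : Mtilde X k :=
  exist _ (@pi_map X k z) (pi_map_im k z).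

(* Main.v *)
Require Import Defs.
From HB Require Import structures.
From mathcomp Require Import all_boot all_order all_algebra.
From mathcomp Require Import boolp freeg.
Import Order.TTheory GRing.Theory Num.Theory.

Set Implicit Arguments.
Unset Strict Implicit.
Unset Printing Implicit Defensive.

Local Open Scope ring_scope.
Local Open Scope quotient_scope.

(** A morphism from a segment to a circle is determined by the image of its
    first edge, because the word on the segment is reduced and so the image
    never turns back. Hence the image under pi_k of a cyclic word c is the sum,
    over the positions i of c, of the classes of the windows of length k of c
    that start at i ([card_lg_hom_window], [pi_gen_window]).

    For a reduced word t of length k - 1 write e(t) for the class of t with the
    sign + if t is the chosen orientation of its class and the sign - if its
    inverse is ([signed]). Reading the definition of the affixes, the left map
    minus the right map sends the class of a reduced word w of length k to
    e(suffix of w) - e(prefix of w) ([pdiff_unsigned]). It is thus a boundary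
    map for the graph whose vertices are the reduced words of length k - 1 and
    whose edges are the reduced words of length k, up to inversion, where a
    vertex and its inverse count with opposite signs. Cyclic words are the
    closed walks of this graph.

    Kernel and image. On the windows of a cyclic word the boundary telescopes,
    and each of the left and right maps sends pi_k to pi_(k-1), as every window
    of length k - 1 is counted either as a suffix or as the inverse of a
    prefix ([pleft_pi_map], [pright_pi_map]). Conversely, let m be in the
    kernel. Every reduced word extends to a cyclically reduced one, so modulo
    the image of pi_k minus the class of a word is a sum of classes of words,
    and m is congruent to a combination with nonnegative coefficients
    ([nonneg_representative]). Such a sum with zero boundary is used up
    by closed walks in the manner of Euler: the boundary of a walk
    that is not closed has a positive coefficient at its end vertex, so one of
    the remaining words, or its inverse, continues it ([extend_walk],
    [walk_circulation_im]).

    Cokernel. If n >= 2, any two reduced words can be joined by at most one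
    letter, so all the e(t) are congruent modulo the image ([signed_connected]).
    Since e(t^-1) = - e(t), twice a generator is zero in the cokernel, which is
    generated by one element; the sum of the coefficients modulo 2 shows that
    this element is not zero ([coker_pdiff]).

    Rank. If n >= 2, the image contains twice each generator of the target, so over the
    rationals the map is onto and its kernel has rank |W_k| - |W_(k-1)|
    ([has_rank_ker]); and |W_k| = n (2n - 1)^(k-1) ([card_uword]). *)

(** * Morphisms from a segment to a circle *)

Section Windows.
Variables (T : eqType) (x0 : T).
Implicit Types (s : seq T) (e : rel T).

(** Indices are cyclic; the default value x0 is never reached unless s is empty. *)
Definition cnth s i := nth x0 s (i %% size s).

Definition window k s i := mkseq (fun j => cnth s (i + j)) k.

Lemma size_window k s i : size (window k s i) = k.
Proof. exact: size_mkseq. Qed.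

Lemma nth_window k s i j : (j < k)%N -> nth x0 (window k s i) j = cnth s (i + j).
Proof. exact: nth_mkseq. Qed.

Lemma window_mod k s i : window k s (i %% size s) = window k s i.
Proof. by apply: eq_mkseq => j; rewrite /cnth modnDml. Qed.

Lemma behead_window k s i : behead (window k.+1 s i) = window k s i.+1.
Proof.
rewrite /window /mkseq /= (iotaDl 1 0) -map_comp.
by apply: eq_map => j /=; rewrite addnS.
Qed.

Lemma take_window k s i : take k (window k.+1 s i) = window k s i.
Proof. by rewrite /window /mkseq -map_take take_iota (minn_idPl (leqnSn k)). Qed.

Lemma cycle_cnth e s : s != [::] ->
  cycle e s <-> forall i, e (cnth s i) (cnth s i.+1).
Proof.
case: s => // x s _; rewrite /= /cnth /=.
have nthE i : (i <= size s)%N ->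
    nth x0 (x :: rcons s x) i = nth x0 (x :: s) (i %% (size s).+1) /\
    nth x0 (rcons s x) i = nth x0 (x :: s) (i.+1 %% (size s).+1).
  move=> le_i; rewrite modn_small //; split.
    by case: i le_i => //= i lt_i; rewrite nth_rcons lt_i.
  rewrite nth_rcons; have [lt_i|ge_i] := ltnP; first by rewrite modn_small.
  have -> : i = size s by apply/eqP; rewrite eqn_leq le_i.
  by rewrite eqxx modnn.
split=> [/(pathP x0) h i|h].
  have lt_i : (i %% (size s).+1 < (size s).+1)%N by rewrite ltn_mod.
  have := h (i %% (size s).+1)%N; rewrite size_rcons => /(_ lt_i).
  have [-> ->] := nthE _ lt_i; rewrite modn_mod.
  by rewrite -[(_ %% _).+1]addn1 modnDml addn1.
by apply/(pathP x0) => i; rewrite size_rcons => /nthE[-> ->].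
Qed.

Lemma sum_window_succ (V : zmodType) (F : seq T -> V) k s :
  \sum_(i < size s) F (window k s i.+1) = \sum_(i < size s) F (window k s i).
Proof.
rewrite [RHS](reindex (@ordS _)) /=.
  by apply: eq_bigr => i _ ; rewrite window_mod.
by exists (@ord_pred _) => i _; rewrite (ordSK, ord_predK).
Qed.

End Windows.

Section HomCount.
Variables (X : finType) (x0 : letter X) (t s : seq (letter X)).
Hypothesis t_red : word_reduced t.

Let t_gt0 : (0 < size t)%N.
Proof. by case/andP: t_red; rewrite -size_eq0 lt0n. Qed.

Let E := ('I_(size s) * bool)%type.

Definition circle_next (e : E) : E :=
  if e.2 then (ordS e.1, true) else (ord_pred e.1, false).

(** Exactly two edges leave the end of an edge of the circle: its successor and
    its inverse. This is what forces the image of a reduced word to go on in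
    one direction. *)
Lemma circle_srcP (e e' : E) :
  circle_src e' = circle_src (pos_bar e) <-> e' = circle_next e \/ e' = pos_bar e.
Proof.
case: e e' => i [] [j []]; rewrite /circle_src /circle_next /pos_bar /=.
- by split=> [->|[[->]|]]; [left| |].
- by split=> [/(can_inj (@ordSK _))->|[|[->]]]; [right| |].
- by split=> [->|[|[->]]]; [right| |].
- by split=> [<-|[[->]|]]; [left; rewrite ordSK|rewrite ord_predK|].
Qed.

(** The word of length [size t] read on the circle by starting with the edge e and
    never turning back. *)
Definition reading (e : E) :=
  mkseq (fun j => pos_lab (iter j circle_next e)) (size t).

Definition reading_hom (e : E) : lg_maps (segment t) (circle s) :=
  ([ffun j : 'I_(size t).+1 => circle_src (iter j circle_next e)],
   [ffun f : 'I_(size t) * bool =>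
     let e' := iter f.1 circle_next e in if f.2 then e' else pos_bar e']).

Lemma reading_homP e : reading e = t -> lg_is_hom (reading_hom e).
Proof.
move=> Ee; apply/lg_homP => -[j b]; rewrite /= !ffunE /=.
have lab_j : pos_lab (iter j circle_next e) = pos_lab (j, true).
  transitivity (nth x0 (reading e) j); first by rewrite nth_mkseq.
  by rewrite Ee /pos_lab (tnth_nth x0).
case: b; rewrite /segment_src /=; split=> //.
- by apply/circle_srcP; left.
- by rewrite pos_barK.
- by rewrite pos_lab_bar lab_j -pos_lab_bar.
Qed.

(** Successive letters of t do not cancel, so the image of an edge of the
    segment cannot be followed by its own inverse; by [circle_srcP] it is
    followed by its successor, and the morphism is known from its first edge. *)
Lemma hom_reading (f : lg_maps (segment t) (circle s)) : lg_is_hom f ->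
  reading (f.2 (Ordinal t_gt0, true)) = t /\
  f = reading_hom (f.2 (Ordinal t_gt0, true)).
Proof.
move=> /lg_homP hf; set e := f.2 _.
have fE (j : 'I_(size t)) : f.2 (j, true) = iter j circle_next e.
  case: j => j; elim: j => [|j IH] lt_j.
    by rewrite /= /e; congr (f.2 (_, _)); apply: val_inj.
  have lt_j' := ltnW lt_j; rewrite /= -(IH lt_j').
  have [s1 _ l1] := hf (Ordinal lt_j, true).
  have [s2 b2 _] := hf (Ordinal lt_j', false).
  have [_ b3 l3] := hf (Ordinal lt_j', true).
  have /circle_srcP[//|E1] : circle_src (f.2 (Ordinal lt_j, true)) =
      circle_src (pos_bar (f.2 (Ordinal lt_j', true))).
    have -> : pos_bar (f.2 (Ordinal lt_j', true)) = f.2 (Ordinal lt_j', false).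
      exact: esym b3.
    rewrite -[LHS]s1 -[RHS]s2; congr (f.1 _); exact: val_inj.
  case/andP: t_red => _ /(sortedP x0)/(_ _ lt_j)/eqP[].
  have := l1; rewrite E1 /= pos_lab_bar => l1'; have := l3.
  by rewrite /= => l3'; move: l1'; rewrite l3' /pos_lab /= !(tnth_nth x0).
split.
  apply: (@eq_from_nth _ x0); rewrite size_mkseq // => j lt_j.
  rewrite nth_mkseq // -(fE (Ordinal lt_j)).
  have [_ _ lE] := hf (Ordinal lt_j, true); apply: (etrans lE).
  by rewrite /= /pos_lab /= (tnth_nth x0).
case: f @e hf fE => f1 f2 e hf fE; rewrite /= in e hf fE *; congr (_, _).
  apply/ffunP => j; rewrite ffunE.
  case: (unliftP ord0 j) => [i|] -> /=.
    have [sE _ _] := hf (i, false); have [_ bE _] := hf (i, true).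
    apply: (etrans sE); rewrite /= (_ : f2 (i, false) = pos_bar (f2 (i, true))) //.
    by rewrite fE; apply/esym/circle_srcP; left.
  have [sE _ _] := hf (Ordinal t_gt0, true).
  by apply: etrans sE; congr (f1 _); exact: val_inj.
apply/ffunP => -[j b]; rewrite ffunE /= -fE; case: b => //.
by have [_ bE _] := hf (j, true); exact: bE.
Qed.

Lemma card_lg_hom_reading :
  #|lg_hom (segment t) (circle s)| = #|[set e | reading e == t]|.
Proof.
have inj : injective reading_hom.
  by move=> e e' [_ /ffunP/(_ (Ordinal t_gt0, true))]; rewrite !ffunE.
rewrite -(card_imset _ inj); apply: eq_card => f; rewrite inE.
apply/idP/imsetP => [/hom_reading[h1 h2]|[e]].
  by exists (f.2 (Ordinal t_gt0, true)); rewrite // inE h1.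
by rewrite inE => /eqP /reading_homP h ->.
Qed.

Lemma val_iter_ordS j (i : 'I_(size s)) :
  iter j (@ordS _) i = ((i + j) %% size s)%N :> nat.
Proof.
elim: j => [|j IH]; first by rewrite addn0 modn_small.
by rewrite /= IH -addn1 modnDml addn1 addnS.
Qed.

Lemma reading_true (i : 'I_(size s)) : reading (i, true) = window x0 (size t) s i.
Proof.
apply: eq_mkseq => j.
have -> : iter j circle_next (i, true) = (iter j (@ordS _) i, true).
  by elim: j => //= j ->.
by rewrite /pos_lab /= (tnth_nth x0) /= val_iter_ordS.
Qed.

Lemma reading_false (i : 'I_(size s)) :
  reading (iter (size t).-1 (@ordS _) i, false) = winv (window x0 (size t) s i).
Proof.
apply: (@eq_from_nth _ x0); rewrite size_mkseq ?size_winv ?size_window // => j lt_j.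
have -> : (size t).-1 = ((size t).-1 - j + j)%N by rewrite subnK // -ltnS prednK.
rewrite nth_mkseq // nth_rev (size_map (@linv X)) size_window //.
rewrite (nth_map x0) ?size_window ?ltn_subrL // nth_window ?ltn_subrL //.
have -> : (size t - j.+1 = (size t).-1 - j)%N by rewrite -subn1 -subnDA add1n.
have nextK m j' : iter j' circle_next (iter (m + j') (@ordS _) i, false) =
    (iter m (@ordS _) i, false).
  elim: j' => [|j' IH]; first by rewrite addn0.
  by rewrite addnS iterSr -IH; congr iter; rewrite /circle_next /= ordSK.
by rewrite nextK /pos_lab /= (tnth_nth x0) /= val_iter_ordS.
Qed.

(** The two summands are the morphisms that run along the circle forwards and
    backwards: reading t backwards and ending at i means that the window that
    starts at i is the inverse of t. *)
Lemma card_lg_hom_window :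
  #|lg_hom (segment t) (circle s)| =
  (\sum_(i < size s)
    ((window x0 (size t) s i == t) + (window x0 (size t) s i == winv t)))%N.
Proof.
rewrite card_lg_hom_reading -sum1_card big_mkcond /=.
transitivity (\sum_(i < size s) \sum_(b : bool) (reading (i, b) == t))%N.
  by rewrite pair_bigA; apply: eq_bigr => -[i b] _; rewrite inE /=; case: eqP.
transitivity (\sum_(i < size s)
    ((reading (i, true) == t) + (reading (i, false) == t)))%N.
  by apply: eq_bigr => i _; exact: big_bool.
rewrite !big_split /=; congr addn.
  by apply: eq_bigr => i _; rewrite reading_true.
(* A backward reading of t that starts with edge i + |t| - 1 ends with edge i. *)
rewrite (reindex (iter (size t).-1 (@ordS _))) /=.
  apply: eq_bigr => i _; rewrite reading_false.
  by rewrite -(inj_eq (can_inj (@winvK X))) winvK.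
exists (iter (size t).-1 (@ord_pred _)) => i _; elim: (_.-1) i => // j IH i.
  by rewrite iterSr iterS ordSK IH.
by rewrite iterSr iterS ord_predK IH.
Qed.

End HomCount.

(** * The maps in terms of oriented words *)

Lemma freeg_eq (L : choiceType) (m m' : {freeg L / int}) :
  (forall x, coeff x m = coeff x m') -> m = m'.
Proof. by move=> h; apply/eqP/freeg_eqP. Qed.

Section FreeModules.
Variables (K : finType).
Implicit Types (m : {freeg K / int}).

Lemma coeff_sumU (F : K -> int) x : coeff x (\sum_y << F y *g y >>) = F x.
Proof.
rewrite raddf_sum (bigD1 x) //= coeffU eqxx mulr1 big1 ?addr0 // => y /negbTE yx.
by rewrite coeffU yx mulr0.
Qed.

Lemma freeg_sumU m : m = \sum_x << x >> *~ coeff x m.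
Proof.
apply: freeg_eq => x; rewrite -[LHS](coeff_sumU (fun y => coeff y m)).
by congr coeff; apply: eq_bigr => y _; rewrite freegU_mulz intz.
Qed.

End FreeModules.

Section Words.
Variable X : finType.
Implicit Types (s t : seq (letter X)) (a b : letter X).

Definition is_rword k t := (size t == k) && word_reduced t.

Lemma is_rwordP k t : is_rword k t -> exists x : rword X k, x = t :> seq _.
Proof.
case/andP => sz red.
by exists (exist (fun w : k.-tuple _ => word_reduced w) (Tuple sz) red).
Qed.

Lemma rword_is_rword k (x : rword X k) : is_rword k x.
Proof. by case: x => x red; rewrite /is_rword /rword_seq /= size_tuple eqxx. Qed.

Lemma is_rword_winv k t : is_rword k (winv t) = is_rword k t.
Proof. by rewrite /is_rword size_winv word_reduced_inv. Qed.

Lemma winv_cons a t : winv (a :: t) = rcons (winv t) (linv a).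
Proof. by rewrite /winv /= rev_cons. Qed.

Lemma take_winv k t : size t = k.+1 -> take k (winv t) = winv (behead t).
Proof.
by case: t => // a t [<-]; rewrite winv_cons -cats1 take_size_cat ?size_winv.
Qed.

Lemma behead_winv k t : size t = k.+1 -> behead (winv t) = winv (take k t).
Proof.
move=> sz; rewrite -[LHS]winvK -(@take_winv k) ?size_winv // winvK //.
Qed.

(** A self-inverse word of odd length would have a middle letter equal to its
    inverse; one of even length would have two middle letters that cancel. *)
Lemma winv_neq t : word_reduced t -> winv t != t.
Proof.
case/andP; rewrite -size_eq0 -lt0n => t_gt0.
have x0 : letter X by case: t t_gt0 => // a _.
move=> /(sortedP x0) red; apply/eqP => E.
have nthE i : (i < size t)%N -> nth x0 t i = linv (nth x0 t (size t - i.+1)).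
  move=> lt_i; rewrite -[in LHS]E nth_rev ?size_map // (nth_map x0) //.
  by rewrite ltn_subrL t_gt0.
have tE := odd_double_half (size t).
case: (boolP (odd (size t))) tE => _ tE.
  have lt_i : ((size t)./2 < size t)%N.
    by rewrite -[X in (_ < X)%N]tE add1n ltnS -addnn leq_addr.
  have := nthE _ lt_i; rewrite -[X in (X - _)%N]tE -addnn add1n subSS addnK.
  by move/esym/eqP; rewrite (negbTE (linv_neq _)).
case: (_./2) tE => [|m] tE; first by rewrite -tE in t_gt0.
have lt_i : (m.+1 < size t)%N by rewrite -tE -addnn add0n addnS ltnS leq_addr.
have := red _ lt_i; rewrite /noncancel [X in _ != linv X]nthE 1?ltnW //.
by rewrite linvK -[X in (X - _)%N]tE -addnn add0n addnK eqxx.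
Qed.

End Words.

Section Orientation.
Variables (X : finType) (o : forall j, uword X j -> rword X j).
Hypothesis ho : forall j (u : uword X j), \pi_(uword X j) (o u) = u.
Implicit Types (s t : seq (letter X)).

(** The class of t if t is the chosen orientation of its class, and 0
    otherwise. This and the next two are total on sequences, with value 0 on
    those that are not reduced words of length k, so that walks need no
    dependent types. *)
Definition chosen k t : M X k :=
  \sum_(u : uword X k) << (t == o u :> seq _)%:R *g u >>.
Definition unsigned k t : M X k := chosen k t + chosen k (winv t).
(** The generator e(t), which changes sign when t is inverted. *)
Definition signed k t : M X k := chosen k t - chosen k (winv t).

Lemma coeff_chosen k u t : coeff u (chosen k t) = (t == o u :> seq _)%:R.
Proof. exact: coeff_sumU. Qed.

Lemma unsigned_winv k t : unsigned k (winv t) = unsigned k t.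
Proof. by rewrite /unsigned winvK addrC. Qed.

Lemma signed_winv k t : signed k (winv t) = - signed k t.
Proof. by rewrite /signed winvK opprB. Qed.

Lemma eq_winv (s t : seq (letter X)) : (winv s == t) = (s == winv t).
Proof. by rewrite -(inj_eq (can_inj (@winvK X))) winvK. Qed.

Lemma pi_eq_o k (x : rword X k) (u : uword X k) :
  (\pi_(uword X k) x == u) = (x == o u :> seq _) || (winv x == o u :> seq _).
Proof. by rewrite -[in LHS](ho u) eqmodE /= /uword_equiv eq_winv. Qed.

Lemma unsigned_rword k (x : rword X k) : unsigned k x = << \pi_(uword X k) x >>.
Proof.
apply: freeg_eq => u; rewrite coeffD !coeff_chosen coeffU mul1r pi_eq_o.
have /andP[_ /winv_neq] := rword_is_rword x.
case: (x =P o u :> seq _) => [<- /negbTE-> //|_ _]; by rewrite add0r.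
Qed.

Lemma unsigned_o k (u : uword X k) : unsigned k (o u) = << u >>.
Proof. by rewrite unsigned_rword ho. Qed.

Lemma chosen_or_opp k t : is_rword k t ->
  exists2 u : uword X k, t = o u \/ t = winv (o u) & unsigned k t = << u >>.
Proof.
case/is_rwordP => x <-; exists (\pi x); last exact: unsigned_rword.
have := eqxx (\pi_(uword X k) x); rewrite {2}[\pi x]lock pi_eq_o -lock.
by case/orP => /eqP E; [left|right; rewrite -E winvK].
Qed.

Section PiGen.
Variables (x0 : letter X) (s : cycred X).

(** Each coefficient on the left is a number of morphisms, which
    [card_lg_hom_window] turns into a count of windows in either direction. *)
Lemma pi_gen_window k : (0 < k)%N ->
  pi_gen k (\pi_(cword X) s) = \sum_(i < size s) unsigned k (window x0 k s i).
Proof.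
move=> k_gt0; apply: freeg_eq => u; rewrite coeff_sumU raddf_sum /=.
have /andP[/eqP sz red] := rword_is_rword (o u).
have iso_u : lg_iso (uword_graph u) (segment (o u)).
  by rewrite -[in uword_graph u](ho u); exact: uword_graph_pi.
rewrite /hom_count (card_lg_hom_iso iso_u (cword_graph_pi s)).
rewrite (card_lg_hom_window x0) // sz -natz natr_sum.
by apply: eq_bigr => i _; rewrite coeffD !coeff_chosen natrD eq_winv.
Qed.

End PiGen.

Lemma prefix_winv s t : prefix (winv s) (winv t) = suffix s t.
Proof.
rewrite /winv prefix_rev !suffixE !size_map -map_drop.
exact: inj_eq (inj_map (can_inj (@linvK X))) _ _.
Qed.

Lemma suffix_winv s t : suffix (winv s) (winv t) = prefix s t.
Proof. by rewrite -prefix_winv !winvK. Qed.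

Section PMaps.
Variables (k : nat) (k_gt0 : (0 < k)%N).
Implicit Types (x : rword X k.+1) (u : uword X k).

Lemma pi_eqP j (x x' : rword X j) :
  \pi_(uword X j) x' == \pi x -> x' = x :> seq _ \/ x' = winv x :> seq _.
Proof. by rewrite eqmodE => /orP[] /eqP; [left|right]. Qed.

Lemma pi_winv j (x x' : rword X j) :
  x' = winv x :> seq _ -> \pi_(uword X j) x' = \pi x.
Proof. by move=> E; apply/eqP; rewrite eqmodE /= /uword_equiv E eqxx orbT. Qed.

Lemma points_outwardE u x :
  points_outward (@o k) u (\pi x) = prefix (winv (o u)) x || suffix (o u) x.
Proof.
apply/existsP/idP => [[x' /andP[/pi_eqP xE]]|h]; last by exists x; rewrite eqxx.
case: xE => -> //.
by rewrite prefix_winv -[X in suffix X (winv _)]winvK suffix_winv orbC.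
Qed.

Lemma points_inwardE u x :
  points_inward (@o k) u (\pi x) = prefix (o u) x || suffix (winv (o u)) x.
Proof.
apply/existsP/idP => [[x' /andP[/pi_eqP xE]]|h]; last by exists x; rewrite eqxx.
case: xE => -> //.
by rewrite suffix_winv -[X in prefix X (winv _)]winvK prefix_winv orbC.
Qed.

(** Links the two halves of the definition of the deltas: a prefix or suffix that
    is an orientation of u witnesses that u is an affix. *)
Lemma affix_rword u x (v : seq (letter X)) : v = o u \/ v = winv (o u) ->
  prefix v x || suffix v x -> affix u (\pi x).
Proof.
move=> vE h; have [|v' v'E] := @is_rwordP X k v.
  by case: vE => ->; rewrite ?is_rword_winv rword_is_rword.
apply/existsP; exists v'; apply/existsP; exists x; rewrite eqxx v'E h andbT /= andbT.
rewrite -[in _ == u](ho u).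
case: vE v'E => -> v'E; first by rewrite eqmodE /= /uword_equiv v'E eqxx.
by apply/eqP; apply: pi_winv.
Qed.

Lemma delta_leftE u x :
  delta_left o (k := k.+1) u (\pi x) = prefix (winv (o u)) x || suffix (o u) x.
Proof.
rewrite /delta_left points_outwardE.
have [h|] := boolP (_ || _); last by rewrite andbF.
rewrite andbT; congr nat_of_bool.
case/orP: h => h.
  by apply: (@affix_rword u x (winv (o u))); rewrite ?h; auto.
by apply: (@affix_rword u x (o u)); rewrite ?h ?orbT; auto.
Qed.

Lemma delta_rightE u x :
  delta_right o (k := k.+1) u (\pi x) = prefix (o u) x || suffix (winv (o u)) x.
Proof.
rewrite /delta_right points_inwardE.
have [h|] := boolP (_ || _); last by rewrite andbF.
rewrite andbT; congr nat_of_bool.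
case/orP: h => h.
  by apply: (@affix_rword u x (o u)); rewrite ?h; auto.
by apply: (@affix_rword u x (winv (o u))); rewrite ?h ?orbT; auto.
Qed.

Lemma prefix_affixE (v t : seq (letter X)) :
  size v = k -> size t = k.+1 -> prefix v t = (take k t == v).
Proof. by move=> sv st; rewrite prefixE sv. Qed.

Lemma suffix_affixE (v t : seq (letter X)) :
  size v = k -> size t = k.+1 -> suffix v t = (behead t == v).
Proof. by move=> sv st; rewrite suffixE sv st subSnn drop1. Qed.

(** Otherwise t would be its own inverse. It follows that the two conditions
    that define a delta never hold together, and a delta is the sum of their
    truth values. *)
Lemma affixes_not_winv t : is_rword k.+1 t -> take k t <> winv (behead t).
Proof.
case/andP => /eqP sz red E; case/eqP: (winv_neq red).
have Et : take k (winv t) = take k t by rewrite (take_winv sz).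
have Eb : behead (winv t) = behead t by rewrite (behead_winv sz) E winvK.
case: t (winv t) sz Et Eb {red E} => // a t [|b t'] /=.
  by case: k k_gt0.
by case: k k_gt0 => // k' _ _ [-> _] ->.
Qed.

Lemma pleft_unsigned t : is_rword k.+1 t ->
  pleft o (unsigned k.+1 t) = chosen k (behead t) + chosen k (winv (take k t)).
Proof.
move=> tP; have [x xE] := is_rwordP tP; have := tP; rewrite -xE => /andP[/eqP sz red].
rewrite unsigned_rword /pleft liftU scale1r; apply: freeg_eq => u.
rewrite coeffD !coeff_chosen coeff_sumU delta_leftE.
have /andP[/eqP su _] := rword_is_rword (o u).
rewrite prefix_affixE ?size_winv // suffix_affixE // -eq_winv.
case: (winv _ =P _) => [E1|_]; case: (behead _ =P _) => [E2|_] //=.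
by case: (affixes_not_winv tP); rewrite -xE E2 -E1 winvK.
Qed.

Lemma pright_unsigned t : is_rword k.+1 t ->
  pright o (unsigned k.+1 t) = chosen k (winv (behead t)) + chosen k (take k t).
Proof.
move=> tP; have [x xE] := is_rwordP tP; have := tP; rewrite -xE => /andP[/eqP sz red].
rewrite unsigned_rword /pright liftU scale1r; apply: freeg_eq => u.
rewrite coeffD !coeff_chosen coeff_sumU delta_rightE.
have /andP[/eqP su _] := rword_is_rword (o u).
rewrite prefix_affixE // suffix_affixE ?size_winv // -eq_winv.
case: (winv _ =P _) => [E1|_]; case: (take _ _ =P _) => [E2|_] //=.
by case: (affixes_not_winv tP); rewrite -xE E2 -E1.
Qed.

(** The difference of the two maps is the boundary map of the graph of
    overlapping words. *)
Lemma pdiff_unsigned t : is_rword k.+1 t ->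
  pleft o (unsigned k.+1 t) - pright o (unsigned k.+1 t) =
  signed k (behead t) - signed k (take k t).
Proof.
move=> tP; rewrite pleft_unsigned // pright_unsigned // /signed.
by rewrite opprD opprB addrACA.
Qed.

End PMaps.
End Orientation.

(** * The kernel is spanned by closed walks *)

Lemma freeg_additive_ext (K : choiceType) (V : zmodType)
    (f g : {additive {freeg K / int} -> V}) :
  (forall x, f << x >> = g << x >>) -> f =1 g.
Proof.
move=> fg m; rewrite -[m]freeg_sumE !raddf_sum; apply: eq_bigr => x _.
by rewrite -[coeff x m]intz -freegU_mulz !raddfMz fg.
Qed.

Section CyclicWords.
Variable X : finType.
Implicit Types (s t : seq (letter X)) (a b c : letter X).

Lemma cyc_reduced_window (x0 : letter X) k s i :
  word_cyc_reduced s -> is_rword k.+1 (window x0 k.+1 s i).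
Proof.
case/andP => s0 /(cycle_cnth x0 _ s0) red.
rewrite /is_rword size_window eqxx; apply/andP; split=> //.
apply/(sortedP x0) => j; rewrite size_window => lt_j.
by rewrite !nth_window ?(ltnW lt_j) // addnS; exact: red.
Qed.

(** With a single generator a reduced word is a power of one letter. *)
Lemma path_one_generator a t : (forall c, c.1 = a.1) ->
  path (@noncancel X) a t -> last a t = a.
Proof.
move=> one; elim: t => //= b t IH /andP[nab]; suff -> : b = a by exact: IH.
move: nab (one b); case: a b {one IH} => x c [y d] /= + E.
by rewrite {y}E; case: c; case: d => //; rewrite /noncancel eqxx.
Qed.

(** If the last letter of t cancels the first one, a letter of another
    generator put between them does not cancel with either; and if there is
    only one generator, the two letters are equal and do not cancel. *)
Lemma cyc_reduced_extension t : word_reduced t ->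
  exists r, word_cyc_reduced (t ++ r).
Proof.
case: t => // a t /andP[_ /= red]; rewrite /word_cyc_reduced /=.
have [nc|/negPn/eqP aE] := boolP (noncancel (last a t) a).
  by exists [::]; rewrite cats0 rcons_path red.
have [/existsP[c ca]|/existsPn one] := boolP [exists c : letter X, c.1 != a.1].
  exists [:: c]; rewrite cats1 !rcons_path red last_rcons /= /noncancel -aE.
  by apply/andP; split; apply: contraNneq ca => ->.
have := path_one_generator (fun c => eqP (negPn (one c))) red.
by move=> E; move: aE; rewrite E => /eqP; rewrite eq_sym (negbTE (linv_neq _)).
Qed.

End CyclicWords.

Section Flow.
Variables (X : finType) (o : forall j, uword X j -> rword X j).
Hypothesis ho : forall j (u : uword X j), \pi_(uword X j) (o u) = u.
Variables (k : nat) (k_gt0 : (0 < k)%N).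
Implicit Types (s t : seq (letter X)) (p l : seq (seq (letter X))).

Lemma cword_letter (c : cword X) : letter X.
Proof. by have := svalP (repr c); case: (sval _) => // a. Qed.

(** Along a cyclic word each window of length k is the suffix of one window of
    length k + 1 and the prefix of the next. The left map counts it the first
    time if it is the chosen orientation and the second time if its inverse is;
    the right map does the opposite. *)
Lemma affix_maps_pi_gen (c : cword X) :
  pleft o (pi_gen k.+1 c) = pi_gen k c /\ pright o (pi_gen k.+1 c) = pi_gen k c.
Proof.
have x0 := cword_letter c; rewrite -[c]reprK !(pi_gen_window ho x0) //.
set s := repr c; have s_red : word_cyc_reduced s := svalP s.
have succ (F : seq (letter X) -> M X k) := sum_window_succ x0 F k s; split.
  rewrite raddf_sum.
  transitivity (\sum_(i < size s) (chosen o k (window x0 k s i.+1) +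
      chosen o k (winv (window x0 k s i)))).
    apply: eq_bigr => i _; rewrite /= (pleft_unsigned ho) ?cyc_reduced_window //.
    by rewrite behead_window take_window.
  by rewrite big_split /= (succ (chosen o k)) -big_split.
rewrite raddf_sum.
transitivity (\sum_(i < size s) (chosen o k (winv (window x0 k s i.+1)) +
    chosen o k (window x0 k s i))).
  apply: eq_bigr => i _; rewrite /= (pright_unsigned ho) ?cyc_reduced_window //.
  by rewrite behead_window take_window.
rewrite big_split /= (succ (fun t => chosen o k (winv t))) -big_split.
by apply: eq_bigr => i _; rewrite /= addrC.
Qed.

Lemma pleft_pi_map z : pleft o (pi_map k.+1 z) = pi_map k z.
Proof.
pose f : {additive ZC X -> M X k} := @pleft X o k.+1 \o @pi_map X k.+1.
pose g : {additive ZC X -> M X k} := @pi_map X k.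
apply: (freeg_additive_ext (f := f) (g := g)).
by move=> c; rewrite /f /g /= /pi_map !liftU !scale1r; have [] := affix_maps_pi_gen c.
Qed.

Lemma pright_pi_map z : pright o (pi_map k.+1 z) = pi_map k z.
Proof.
pose f : {additive ZC X -> M X k} := @pright X o k.+1 \o @pi_map X k.+1.
pose g : {additive ZC X -> M X k} := @pi_map X k.
apply: (freeg_additive_ext (f := f) (g := g)).
by move=> c; rewrite /f /g /= /pi_map !liftU !scale1r; have [] := affix_maps_pi_gen c.
Qed.

Definition overlap : rel (seq (letter X)) := fun s t => behead s == take k t.

(** The first letters of the words of a closed walk spell a cyclic word whose
    windows are the words of the walk. *)
Lemma closed_walk_im p : p != [::] -> all (is_rword k.+1) p -> cycle overlap p ->
  \sum_(t <- p) unsigned o k.+1 t \in im (@pi_map X k.+1).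
Proof.
move=> p0 pP /(cycle_cnth [::] _ p0) walk.
have cnthP i : is_rword k.+1 (cnth [::] p i).
  by apply: (allP pP); rewrite mem_nth // ltn_mod lt0n size_eq0.
have x0 : letter X by have := cnthP 0%N; case: (cnth _ _ _) => // a.
pose s := map (head x0) p.
have winE i : cnth [::] p i = window x0 k.+1 s i.
  have /andP[/eqP sz _] := cnthP i.
  apply: (@eq_from_nth _ x0); rewrite sz ?size_window // => j lt_j.
  rewrite nth_window //; elim: j i lt_j {sz} => [|j IH] i lt_j.
    rewrite addn0 nth0 /cnth size_map (nth_map [::]) // ltn_mod lt0n size_eq0 //.
  by rewrite -nth_behead (eqP (walk i)) nth_take // IH ?addSnnS // ltnW.
have s0 : s != [::] by rewrite -size_eq0 size_map size_eq0.
have s_red : word_cyc_reduced s.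
  rewrite /word_cyc_reduced s0; apply/(cycle_cnth x0 _ s0) => i.
  have /andP[_ /andP[_ /(sortedP x0)]] := cnthP i.
  rewrite winE size_window => /(_ 0%N k_gt0).
  by rewrite !nth_window // addn0 addn1.
apply/asboolP; exists << \pi_(cword X) (exist _ s s_red) >>.
rewrite /pi_map liftU scale1r (pi_gen_window ho x0) // (big_nth [::]) big_mkord.
rewrite /cycred_seq /= size_map; apply: eq_bigr => i _.
by rewrite -winE /cnth modn_small.
Qed.

Definition boundary t : M X k := signed o k (behead t) - signed o k (take k t).

Lemma telescope_boundary x p : path overlap x p ->
  \sum_(t <- x :: p) boundary t =
  signed o k (behead (last x p)) - signed o k (take k x).
Proof.
elim: p x => [|y p IH] x; first by rewrite big_seq1.
rewrite big_cons /= => /andP[/eqP xy /IH ->]; rewrite /boundary xy.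
by rewrite addrC addrA subrK.
Qed.

Lemma boundary_winv t : is_rword k.+1 t -> boundary (winv t) = boundary t.
Proof.
case/andP => /eqP sz _; rewrite /boundary (behead_winv sz) (take_winv sz).
by rewrite !signed_winv opprK addrC.
Qed.

(** A linear form that picks out the coefficient of e(v), whichever of v and its
    inverse is the chosen orientation. *)
Lemma signed_test v : is_rword k v -> exists (u : uword X k) (c : int),
  forall t, coeff u (signed o k t) * c = (t == v)%:R - (t == winv v)%:R.
Proof.
case/(chosen_or_opp ho) => u [] -> _; exists u.
  by exists 1 => t; rewrite mulr1 coeffB !coeff_chosen eq_winv.
by exists (-1) => t; rewrite mulrN1 coeffB !coeff_chosen eq_winv winvK opprB.
Qed.

Lemma is_rword_affix t : is_rword k.+1 t ->
  is_rword k (behead t) /\ is_rword k (take k t).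
Proof.
case/andP => /eqP sz /andP[_ red]; rewrite /is_rword /word_reduced -!size_eq0.
rewrite size_behead size_take sz ltnSn eqxx -lt0n k_gt0 take_sorted //.
by split=> //; case: t red {sz} => //= a t /path_sorted.
Qed.

(** Evaluate the form of [signed_test] at the end vertex v of the walk on the
    zero total boundary. The walk contributes at least 1, so some remaining
    word contributes a negative number, and this is possible only for a word
    that, up to inversion, starts at v. *)
Lemma extend_walk x p l : all (is_rword k.+1) (x :: p ++ l) ->
  path overlap x p -> behead (last x p) != take k x ->
  \sum_(t <- x :: p ++ l) boundary t = 0 ->
  exists2 t, t \in l & overlap (last x p) t \/ overlap (last x p) (winv t).
Proof.
move=> allP walk open_walk; rewrite -cat_cons big_cat /= telescope_boundary //.
set v := behead _ in open_walk *.
have rwP t : t \in x :: p ++ l -> is_rword k.+1 t by move/(seq.allP allP).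
have vP : is_rword k v.
  have [] // := is_rword_affix (rwP (last x p) _).
  by rewrite -cat_cons mem_cat mem_last.
have [u [c test]] := signed_test vP.
move/(congr1 (fun m => coeff u m * c)); rewrite coeff0 mul0r => sum0.
have [/hasP[t tl /orP ov]|/hasPn no_ov] :=
    boolP (has (fun t => overlap (last x p) t || overlap (last x p) (winv t)) l).
  by exists t.
suff: 0 < coeff u (signed o k v - signed o k (take k x) +
    \sum_(t <- l) boundary t) * c.
  by rewrite sum0.
rewrite coeffD coeffB raddf_sum mulrDl mulrBl mulr_suml !test.
have [_ red_v] := andP vP; rewrite eqxx [v == _]eq_sym (negbTE (winv_neq red_v)).
rewrite [take _ _ == v]eq_sym (negbTE open_walk) !subr0 sub0r opprK.
apply: ltr_pwDl; first by case: (_ == _).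
rewrite big_seq; apply: sumr_ge0 => t tl /=; have := no_ov _ tl.
have tP : is_rword k.+1 t by apply: rwP; rewrite -cat_cons mem_cat tl orbT.
have [/eqP sz _] := andP tP.
rewrite /overlap -/v (take_winv sz) [v == winv _]eq_sym eq_winv [v == take _ _]eq_sym.
rewrite coeffB mulrBl !test; case/norP => /negbTE -> /negbTE ->.
by case: (_ == _); case: (_ == _).
Qed.

(** Induction on the number of remaining words: an open walk takes one of them,
    a closed walk is removed and a new walk starts. *)
Lemma walk_circulation_im x p l : all (is_rword k.+1) (x :: p ++ l) ->
  path overlap x p -> \sum_(t <- x :: p ++ l) boundary t = 0 ->
  \sum_(t <- x :: p ++ l) unsigned o k.+1 t \in im (@pi_map X k.+1).
Proof.
have [n] := ubnP (size l); elim: n => // n IH in x p l *; rewrite ltnS => le_l.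
move=> allP walk sum0.
have [closed|open_walk] := eqVneq (behead (last x p)) (take k x); last first.
  have [t tl ov] := extend_walk allP walk open_walk sum0.
  have [t' [ov' t'P eqU eqB]] : exists t', [/\ overlap (last x p) t', is_rword k.+1 t',
      unsigned o k.+1 t' = unsigned o k.+1 t & boundary t' = boundary t].
    have tP : is_rword k.+1 t.
      by apply: (seq.allP allP); rewrite -cat_cons mem_cat tl orbT.
    case: ov => ov; first by exists t.
    by exists (winv t); rewrite is_rword_winv unsigned_winv boundary_winv.
  have lE := perm_to_rem tl.
  have sumE (V : zmodType) (F : seq (letter X) -> V) : F t' = F t ->
      \sum_(s <- x :: p ++ l) F s = \sum_(s <- x :: rcons p t' ++ rem t l) F s.
    move=> eqF; rewrite -!cat_cons !big_cat /=.
    rewrite (_ : \sum_(s <- l) F s = F t' + \sum_(s <- rem t l) F s).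
      by rewrite -rcons_cons -cats1 big_cat big_seq1 addrA.
    by rewrite (perm_big _ lE) big_cons eqF.
  rewrite (sumE _ _ eqU); rewrite (sumE _ _ eqB) in sum0; apply: IH => //.
  - by rewrite size_rem //; case: (l) tl le_l.
  - move: allP; rewrite /= cat_rcons !all_cat /= t'P => /and3P[-> -> lP] /=.
    by apply/allP => s /mem_rem; exact: (seq.allP lP).
  - by rewrite rcons_path walk.
have walk_im : \sum_(t <- x :: p) unsigned o k.+1 t \in im (@pi_map X k.+1).
  apply: closed_walk_im => //=; last by rewrite rcons_path walk /overlap closed eqxx.
  by move: allP; rewrite -cat_cons all_cat => /andP[].
move: sum0 allP; rewrite -cat_cons !big_cat /= telescope_boundary // closed.
rewrite subrr add0r all_cat => sum0 /and3P[_ _ lP]; apply: rpredD => //.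
case: l le_l lP sum0 => [|y l] le_l lP sum0; first by rewrite big_nil rpred0.
exact: (IH y [::] l).
Qed.

Lemma circulation_im l : all (is_rword k.+1) l -> \sum_(t <- l) boundary t = 0 ->
  \sum_(t <- l) unsigned o k.+1 t \in im (@pi_map X k.+1).
Proof.
case: l => [|x l] lP sum0; first by rewrite big_nil rpred0.
exact: (walk_circulation_im (p := [::])).
Qed.

(** A cyclically reduced extension of t has t as its first window; the other
    windows form the list. *)
Lemma opp_unsigned_representative t : is_rword k.+1 t ->
  exists2 l, all (is_rword k.+1) l &
    - unsigned o k.+1 t - \sum_(s <- l) unsigned o k.+1 s \in im (@pi_map X k.+1).
Proof.
case/andP => /eqP sz red; have [r s_red] := cyc_reduced_extension red.
set s := t ++ r in s_red.
have x0 : letter X by case: t red {sz s s_red}.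
have [n sE] : exists n, size s = n.+1 by rewrite size_cat sz; exists (k + size r)%N.
exists [seq window x0 k.+1 s i.+1 | i <- iota 0 n].
  by apply/allP => w /mapP[i _ ->]; exact: cyc_reduced_window.
rewrite -opprD rpredN big_map; apply/asboolP.
exists << \pi_(cword X) (exist _ s s_red) >>.
rewrite /= /pi_map liftU scale1r (pi_gen_window ho x0) // /cycred_seq /= sE.
rewrite big_ord_recl -[in RHS](subn0 n) big_mkord; congr (unsigned _ _ _ + _).
apply: (@eq_from_nth _ x0); rewrite size_window ?sz // => i lt_i.
rewrite nth_window // add0n /cnth modn_small ?nth_cat ?sz ?lt_i //.
by rewrite sE -sE size_cat sz (leq_trans lt_i) ?leq_addr.
Qed.

(** Modulo the image of pi every element is a sum of words, so the greedy
    argument for lists of words applies to all elements. *)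
Lemma nonneg_representative (m : M X k.+1) : exists2 l, all (is_rword k.+1) l &
  m - \sum_(t <- l) unsigned o k.+1 t \in im (@pi_map X k.+1).
Proof.
pose P (m : M X k.+1) := exists2 l, all (is_rword k.+1) l &
  m - \sum_(t <- l) unsigned o k.+1 t \in im (@pi_map X k.+1).
have P0 : P 0 by exists [::] => //; rewrite big_nil subrr rpred0.
have PD m1 m2 : P m1 -> P m2 -> P (m1 + m2).
  move=> [l1 h1 i1] [l2 h2 i2]; exists (l1 ++ l2); first by rewrite all_cat h1.
  by rewrite big_cat /= opprD addrACA rpredD.
have PU u : P << u >>.
  exists [:: o u : seq _]; first by rewrite /= rword_is_rword.
  by rewrite big_seq1 unsigned_o // subrr rpred0.
have PN u : P (- << u >>).
  have [l lP] := opp_unsigned_representative (rword_is_rword (o u)).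
  by rewrite unsigned_o //; exists l.
have PM m1 n : P m1 -> P (m1 *+ n).
  by move=> h; elim: n => [|n IH]; rewrite ?mulr0n // mulrS; exact: PD.
rewrite -/(P m) [m]freeg_sumU; apply: big_ind => // u _.
case: (coeff u m) => n; first by rewrite -pmulrn; exact: PM.
by rewrite NegzE mulrNz -pmulrn -mulNrn; exact: PM.
Qed.

Lemma ker_sub_im (m : M X k.+1) :
  pleft o m - pright o m = 0 -> m \in im (@pi_map X k.+1).
Proof.
move=> m_ker; have [l lP h] := nonneg_representative m.
rewrite -(subrK (\sum_(t <- l) unsigned o k.+1 t) m); apply: rpredD => //.
apply: circulation_im => //; move/asboolP: h => [z zE].
pose D : {additive M X k.+1 -> M X k} := @pleft X o k.+1 \- @pright X o k.+1.
have Dz : D (pi_map k.+1 z) = 0.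
  by rewrite /D /= pleft_pi_map pright_pi_map subrr.
have {}m_ker : D m = 0 by [].
transitivity (D (\sum_(t <- l) unsigned o k.+1 t)).
  rewrite raddf_sum !big_seq; apply: eq_bigr => t /(seq.allP lP) tP.
  exact/esym/pdiff_unsigned.
have -> : \sum_(t <- l) unsigned o k.+1 t = m - pi_map k.+1 z.
  by rewrite zE opprB addrCA subrr addr0.
by rewrite raddfB m_ker Dz subrr.
Qed.

End Flow.

(** * The cokernel *)

Section CokerZ2.
Variables (A : zmodType) (K : choiceType) (f : {additive A -> {freeg K / int}}).

(** The hypotheses say that f hits only even degrees, that the cokernel is
    generated by the class of u, and that this class has order at most 2. *)
Lemma coker_Z2 (u : K) :
  (forall a, (deg (f a))%:~R = 0 :> 'Z_2) ->
  << u >> *+ 2 \in im f ->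
  (forall m, m - << u >> *~ deg m \in im f) ->
  exists phi : {additive coker f -> 'Z_2}, bijective phi.
Proof.
move=> deg_f two_u gen_u.
(* The degree modulo 2 is constant on the classes of the cokernel. *)
pose phi (q : coker f) : 'Z_2 := (deg (repr q))%:~R.
have phiE m : phi (\pi_(coker f) m) = (deg m)%:~R.
  have /eqP := reprK (\pi_(coker f) m); rewrite -Quotient.idealrBE.
  move=> /asboolP[a aE]; apply/eqP; rewrite -subr_eq0 -intrB -degB -aE.
  by rewrite deg_f.
have piB x y : \pi_(coker f) (x - y) = \pi_(coker f) x - \pi_(coker f) y.
  by rewrite !piE.
have phi_add : zmod_morphism phi.
  by move=> q q'; rewrite -[q]reprK -[q']reprK -piB !phiE degB intrB.
pose phiM := GRing.isZmodMorphism.Build _ _ phi phi_add.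
pose phi' : {additive coker f -> 'Z_2} := HB.pack phi phiM.
exists phi'; have phi_inj : injective phi'.
  apply: raddf_inj => q; rewrite -[q]reprK; set m := repr q => /=.
  rewrite phiE => m0; transitivity (\pi_(coker f) 0).
    2: by rewrite -(subrr 0) piB subrr.
  apply/eqP; rewrite -Quotient.idealrBE subr0 -[m](subrK (<< u >> *~ deg m)).
  apply: rpredD => //; suff [z ->] : exists z, deg m = z * 2%:R.
    by rewrite [z * _]mulrC mulrzA natz -pmulrn; apply: rpredMz.
  case: (deg m) m0 => n /eqP.
    rewrite -pmulrn -val_eqE /= val_Zp_nat // -[_ == _]/(2 %| n)%N.
    by case/dvdnP=> z ->; exists z.
  rewrite NegzE rmorphN /= oppr_eq0 -pmulrn -val_eqE /= val_Zp_nat //.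
  rewrite -[_ == _]/(2 %| n.+1)%N.
  by case/dvdnP=> z ->; exists (- z%:Z); rewrite mulNr.
pose psi (z : 'Z_2) : coker f := \pi_(coker f) (<< u >> *+ z).
have phi_psi : cancel psi phi'.
  by move=> z; rewrite /psi /= phiE degMn degU natz -pmulrn natr_Zp.
by exists psi => //; move=> q; apply: phi_inj; rewrite phi_psi.
Qed.

End CokerZ2.

Section Connected.
Variables (X : finType) (o : forall j, uword X j -> rword X j).
Hypothesis ho : forall j (u : uword X j), \pi_(uword X j) (o u) = u.
Variables (k : nat) (k_gt0 : (0 < k)%N).
Hypothesis X_gt1 : (1 < #|X|)%N.
Implicit Types (s t v w : seq (letter X)).

Definition pdiff : {additive M X k.+1 -> M X k} :=
  @pleft X o k.+1 \- @pright X o k.+1.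

Lemma other_generator (a : letter X) : exists c : letter X, c.1 != a.1.
Proof.
have [x] : exists x, x \in [set~ a.1].
  by apply/set0Pn; rewrite -card_gt0 cardsC1 -subn1 subn_gt0.
by rewrite !inE => xa; exists (x, true).
Qed.

(** If the last letter of v cancels the first one of w, a letter of another
    generator separates them. *)
Lemma reduced_join v w : word_reduced v -> word_reduced w ->
  exists r, word_reduced (v ++ r ++ w).
Proof.
case: v => // b v /andP[_ /= v_red]; case: w => // a w /andP[_ /= w_red].
have [nc|/negPn/eqP aE] := boolP (noncancel (last b v) a).
  by exists [::]; rewrite /word_reduced /= cat_path v_red /= nc.
have [c ca] := other_generator a; exists [:: c].
rewrite /word_reduced /= cat_path v_red /= w_red /noncancel -aE andbT.
by apply/andP; split; apply: contraNneq ca => ->.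
Qed.

(** The subwords of length k + 1 of s form a walk from its prefix to its suffix. *)
Lemma signed_prefix_suffix s : word_reduced s -> (k <= size s)%N ->
  signed o k (drop (size s - k) s) - signed o k (take k s) \in im pdiff.
Proof.
elim: s => // a s IH /andP[_ /= red] le_k.
have [lt_k|ge_k] := ltnP (size s) k.
  have kE : (size s).+1 = k by apply/eqP; rewrite eqn_leq le_k andbT.
  by rewrite kE subnn drop0 take_oversize ?subrr ?rpred0 //= kE.
have s_red : word_reduced s.
  rewrite /word_reduced (path_sorted red) andbT -size_eq0 -lt0n.
  exact: leq_trans ge_k.
rewrite /= subSn // /= -[signed o k (drop _ _)](subrK (signed o k (take k s))).
rewrite -addrA; apply: rpredD; first exact: IH.
have tP : is_rword k.+1 (take k.+1 (a :: s)).
  by rewrite /is_rword size_takel ?ltnS // eqxx /word_reduced /= take_path.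
apply/asboolP; exists (unsigned o k.+1 (take k.+1 (a :: s))).
rewrite /pdiff /= pdiff_unsigned //=.
by case: k k_gt0 => //= k0 _; rewrite take_takel.
Qed.

Lemma signed_connected v w : is_rword k v -> is_rword k w ->
  signed o k w - signed o k v \in im pdiff.
Proof.
move=> /andP[/eqP sv v_red] /andP[/eqP sw w_red].
have [r red] := reduced_join v_red w_red.
have := signed_prefix_suffix red; rewrite !size_cat sv leq_addr => /(_ isT).
by rewrite take_size_cat // catA drop_size_cat // size_cat sv sw addnA addnK.
Qed.

(** The inverse of the chosen orientation is never chosen, since a reduced word
    differs from its inverse. *)
Lemma signed_o (u : uword X k) : signed o k (o u) = << u >>.
Proof.
rewrite /signed -(unsigned_o ho) /unsigned; congr (_ + _).
suff -> : chosen o k (winv (o u)) = 0 by rewrite oppr0.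
apply: freeg_eq => u'; rewrite coeff_chosen coeff0; case: eqP => // E.
have uE : u = u' by rewrite -(ho u) -(ho u'); exact/esym/pi_winv.
have /andP[_ /winv_neq] := rword_is_rword (o u).
by rewrite {2}uE E eqxx.
Qed.

(** A word can be joined to its inverse, and e changes sign under inversion. *)
Lemma double_generator_im (u : uword X k) : << u >> *+ 2 \in im pdiff.
Proof.
have h := rword_is_rword (o u).
have := @signed_connected (winv (o u)) (o u); rewrite is_rword_winv => /(_ h h).
by rewrite signed_winv opprK signed_o mulr2n.
Qed.

Lemma congr_deg_im (u : uword X k) m : m - << u >> *~ deg m \in im pdiff.
Proof.
have -> : deg m = \sum_x coeff x m.
  rewrite {1}[m]freeg_sumU raddf_sum; apply: eq_bigr => x _.
  by rewrite freegU_mulz /= degU intz.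
rewrite {1}[m]freeg_sumU mulrz_sumr -sumrB; apply: rpred_sum => x _.
rewrite -mulrzBl; apply: rpredMz; rewrite -!signed_o.
by apply: signed_connected; exact: rword_is_rword.
Qed.

Lemma deg_signed t : is_rword k t -> (deg (signed o k t))%:~R = 1 :> 'Z_2.
Proof.
move=> /(chosen_or_opp ho)[u _ tE].
have -> : signed o k t = unsigned o k t - chosen o k (winv t) *+ 2.
  by rewrite /signed /unsigned mulr2n opprD addrA addrK.
rewrite tE degB degU degMn intrB rmorphMn /= -mulr_natr.
by rewrite (_ : 2%:R = 0) ?mulr0 ?subr0 //; exact: val_inj.
Qed.

(** Modulo 2 signs do not matter, and each word has two affixes. *)
Lemma deg_pdiff m : (deg (pdiff m))%:~R = 0 :> 'Z_2.
Proof.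
have dU (x : uword X k.+1) : (deg (pdiff << x >>))%:~R = 0 :> 'Z_2.
  have [b t] := is_rword_affix k_gt0 (rword_is_rword (o x)).
  rewrite -(unsigned_o ho) /pdiff /= pdiff_unsigned ?rword_is_rword //.
  by rewrite degB intrB !deg_signed // subrr.
rewrite [m]freeg_sumU (raddf_sum pdiff) (raddf_sum (@deg _)) rmorph_sum big1 //.
by move=> x _; rewrite (raddfMz pdiff) (raddfMz (@deg _)) rmorphMz /= dU mul0rz.
Qed.

Lemma exists_uword : exists u : uword X k, True.
Proof.
have [x _] : exists x : X, x \in X by apply/card_gt0P; exact: ltnW.
have [|y _] := @is_rwordP X k (nseq k (x, true)); last by exists (\pi y).
rewrite /is_rword size_nseq eqxx /word_reduced -size_eq0 size_nseq -lt0n k_gt0.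
have xx : noncancel (x, true) (x, true) by rewrite /noncancel eq_sym linv_neq.
by case: k => //= k0; elim: k0 => //= k0; rewrite xx.
Qed.

Lemma coker_pdiff : exists phi : {additive coker pdiff -> 'Z_2}, bijective phi.
Proof.
have [u _] := exists_uword.
exact: (coker_Z2 deg_pdiff (double_generator_im u) (congr_deg_im u)).
Qed.

End Connected.

(** * The rank of the kernel *)

Lemma common_denominator (I : finType) (F : I -> rat) :
  exists2 c : int, c != 0 & exists G : I -> int, forall i, F i * c%:~R = (G i)%:~R.
Proof.
exists (\prod_i denq (F i)).
  by rewrite prodf_seq_neq0; apply/allP => i _; rewrite denq_neq0.
exists (fun i => numq (F i) * \prod_(j | j != i) denq (F j)) => i.
rewrite (bigD1 i) //= !intrM mulrA; congr (_ * _).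
by rewrite -{1}[F i]divq_num_den divfK // intr_eq0 denq_neq0.
Qed.

Section Coordinates.
Variable K : finType.
Implicit Type m : {freeg K / int}.

Definition coords m : 'rV[rat]_#|K| := \row_j (coeff (enum_val j) m)%:~R.

Definition family_mx r (s : r.-tuple {freeg K / int}) : 'M[rat]_(r, #|K|) :=
  \matrix_i coords (tnth s i).

Lemma coords_inj m : coords m = 0 -> m = 0.
Proof.
move=> m0; apply: freeg_eq => x; rewrite coeff0; apply/eqP.
have /rowP/(_ (enum_rank x)) := m0.
by rewrite !mxE enum_rankK => /eqP; rewrite intr_eq0.
Qed.

Lemma mul_family_mx r (s : r.-tuple {freeg K / int}) (c : 'I_r -> int) :
  (\row_i (c i)%:~R) *m family_mx s = coords (\sum_i tnth s i *~ c i).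
Proof.
apply/rowP => j; rewrite !mxE raddf_sum rmorph_sum; apply: eq_bigr => i _.
by rewrite !mxE raddfMz rmorphMz /= mulrzl.
Qed.

(** A rational relation becomes an integral one after multiplication by a common
    denominator. *)
Lemma Zfree_row_free r (s : r.-tuple {freeg K / int}) :
  Zfree s <-> row_free (family_mx s).
Proof.
split=> [free | free c sum0 i].
  apply: inj_row_free => v v0.
  have [c c0 [G GE]] := common_denominator (fun i => v 0 i).
  have GvE : \row_i (G i)%:~R = c%:~R *: v.
    by apply/rowP => i; rewrite !mxE -GE mulrC.
  have /free G0 : \sum_i tnth s i *~ G i = 0.
    by apply: coords_inj; rewrite -mul_family_mx GvE -scalemxAl v0 scaler0.
  apply/rowP => i; have /eqP := GE i; rewrite G0 mulf_eq0 intr_eq0 (negbTE c0) orbF.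
  by rewrite mxE => /eqP.
have : (\row_j (c j)%:~R) *m family_mx s == 0.
  by rewrite mul_family_mx sum0; apply/eqP/rowP => j; rewrite !mxE coeff0.
rewrite mulmx_free_eq0 // => /eqP/rowP/(_ i); rewrite !mxE => /eqP.
by rewrite intr_eq0 => /eqP.
Qed.

End Coordinates.

Section RankKer.
Variables (A B : finType) (f : {additive {freeg A / int} -> {freeg B / int}}).

Definition additive_mx : 'M[rat]_(#|A|, #|B|) :=
  \matrix_i coords (f << enum_val i >>).

Lemma mul_additive_mx m : coords m *m additive_mx = coords (f m).
Proof.
apply/rowP => j; rewrite !mxE {2}[m]freeg_sumU !raddf_sum.
rewrite (reindex (fun j : 'I_#|A| => enum_val j)) /=.
  apply: eq_bigr => i _.
  by rewrite !mxE (raddfMz f) (raddfMz (coeff _)) mulrzz intrM mulrC.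
exact: onW_bij (enum_val_bij _).
Qed.

(** Over the rationals the map is onto, so its kernel has dimension
    |A| - |B|; a basis of this kernel becomes integral after multiplication by
    a common denominator, and an integral family in the kernel that is free
    over the integers is free over the rationals. *)
Lemma has_rank_ker r :
  (forall b, exists a, f a = << b >> *+ 2) -> (r + #|B|)%N = #|A| ->
  has_rank (ker f) r.
Proof.
move=> /fin_all_exists[g gE] rE.
have full : row_full additive_mx.
  (* Halving preimages of the doubled generators gives a left inverse. *)
  apply/row_fullP; exists (2%:R^-1 *: \matrix_j coords (g (enum_val j))).
  apply/row_matrixP => j; rewrite -scalemxAl linearZ /= row_mul rowK mul_additive_mx gE.
  apply/rowP => i; rewrite !mxE coeffMn coeffU mul1r (inj_eq enum_val_inj).
  by case: (_ == _); rewrite ?mul0rn ?mulr0 // -mulr_natr mul1r pmulrn intz mulVf.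
have {}full : \rank additive_mx = #|B| by apply/eqP.
split; last first.
  move=> r' s s_ker /Zfree_row_free s_free; rewrite -(leq_add2r #|B|) rE -full.
  move: s_free; rewrite /row_free => /eqP {1}<-.
  apply: mulmx0_rank_max; apply/row_matrixP => i.
  rewrite row_mul rowK mul_additive_mx.
  have /eqP -> : f (tnth s i) == 0 := s_ker _ (mem_tnth i s).
  by apply/rowP => j; rewrite !mxE coeff0.
have {rE} -> : r = \rank (kermx additive_mx) by rewrite mxrank_ker full -rE addnK.
pose N := row_base (kermx additive_mx).
have [c c0 [G GE]] := common_denominator (fun ij => N ij.1 ij.2).
pose s := mktuple (fun i => \sum_x << (G (i, enum_rank x)) *g x >>).
have sE : family_mx s = c%:~R *: N.
  apply/matrixP => i j; rewrite [LHS]mxE [LHS]mxE [RHS]mxE.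
  rewrite tnth_mktuple coeff_sumU enum_valK.
  by rewrite -GE mulrC.
exists s; last first.
  apply/Zfree_row_free; rewrite sE /row_free mxrank_scale_nz ?intr_eq0 //.
  exact: row_base_free.
move=> m /tnthP[i ->]; apply/eqP; apply: coords_inj.
rewrite -mul_additive_mx -[coords _](rowK (fun i => coords (tnth s i))) -/(family_mx s).
rewrite sE -row_mul -scalemxAl.
have /sub_kermxP -> : (N <= kermx additive_mx)%MS by rewrite eq_row_base.
by rewrite scaler0 row0.
Qed.

End RankKer.

(** The kernel of the zero map to the free module on the empty type. *)
Lemma has_rank_freeg (A : finType) : has_rank (predT : {pred {freeg A / int}}) #|A|.
Proof.
have := @has_rank_ker A void \0 #|A|.
case=> //; first by rewrite card_void addn0.
move=> [s sP free] max; split; first by exists s.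
by move=> r s' _; apply: max => m _; apply/eqP.
Qed.

Lemma eq_has_rank (A : zmodType) (S S' : {pred A}) r :
  S =i S' -> has_rank S r -> has_rank S' r.
Proof.
move=> SS [[s sS free] max]; split.
  by exists s => // m /sS; rewrite SS.
by move=> r' s' s'S; apply: max => m /s'S; rewrite SS.
Qed.

(** * The number of reduced words *)

Section Counting.
Variable X : finType.
Local Open Scope nat_scope.

Lemma sum_tuple_cons k (P : pred (seq (letter X))) :
  \sum_(t : k.+1.-tuple (letter X) | P t) 1 =
  \sum_(b : letter X) \sum_(t : k.-tuple (letter X) | P (b :: t)) 1.
Proof.
pose cons_pair (p : letter X * k.-tuple (letter X)) := cons_tuple p.1 p.2.
rewrite pair_big_dep (reindex cons_pair) //=.
exists (fun t => (thead t, behead_tuple t)) => [[b t] _|t _] /=.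
  by rewrite theadE; congr (_, _); apply: val_inj.
by rewrite [RHS]tuple_eta; apply: val_inj.
Qed.

Lemma card_letter : #|{: letter X}| = 2 * #|X|.
Proof. by rewrite card_prod card_bool mulnC. Qed.

Lemma card_path_tuple k (a : letter X) :
  \sum_(t : k.-tuple (letter X) | path (@noncancel X) a t) 1 = (2 * #|X| - 1) ^ k.
Proof.
elim: k a => [|k IH] a.
  rewrite (eq_bigl predT) => [|t]; last by rewrite tuple0.
  by rewrite sum1_card card_tuple.
rewrite sum_tuple_cons /= (bigD1 (linv a)) //= big1 ?add0n => [|t]; last first.
  by rewrite /noncancel eqxx.
under eq_bigr => b nb.
  rewrite (eq_bigl (fun t : k.-tuple _ => path (@noncancel X) b t)) => [|t].
    rewrite IH; over.
  by rewrite /noncancel nb.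
by rewrite sum_nat_const cardC1 card_letter subn1 expnS.
Qed.

Lemma card_rword k : #|{: rword X k.+1}| = 2 * #|X| * (2 * #|X| - 1) ^ k.
Proof.
rewrite card_sig -sum1_card.
under eq_bigl do rewrite inE.
rewrite (sum_tuple_cons _ (@word_reduced X)).
under eq_bigr => b _ do rewrite card_path_tuple.
by rewrite sum_nat_const card_letter.
Qed.

(** Each class consists of two distinct words, a word and its inverse. *)
Lemma card_uword_double k (o : forall j, uword X j -> rword X j) :
  (forall j (u : uword X j), \pi_(uword X j) (o j u) = u)%qT ->
  2 * #|{: uword X k}| = #|{: rword X k}|.
Proof.
move=> ho; have two (u : uword X k) : #|[pred x | \pi_(uword X k)%qT x == u]| = 2.
  have [y yE] : exists y : rword X k, y = winv (o k u) :> seq _.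
    by apply: is_rwordP; rewrite is_rword_winv rword_is_rword.
  rewrite (eq_card (B := pred2 (o k u) y)) => [|x].
    rewrite card2 (_ : o k u != y) //; apply/eqP => E.
    have /andP[_ /winv_neq] := rword_is_rword (o k u).
    by rewrite -yE -E eqxx.
  by rewrite !inE (pi_eq_o ho) eq_winv -yE -!val_eqE.
rewrite -[RHS]sum1_card (partition_big (fun x => \pi_(uword X k)%qT x) predT) //.
rewrite mulnC -sum_nat_const; apply: eq_bigr => u _.
by rewrite sum1_card -[LHS](two u).
Qed.

Lemma card_uword k (o : forall j, uword X j -> rword X j) :
  (forall j (u : uword X j), \pi_(uword X j) (o j u) = u)%qT ->
  #|{: uword X k.+1}| = #|X| * (2 * #|X| - 1) ^ k.
Proof.
move=> ho; apply/eqP; rewrite -(eqn_pmul2l (m := 2)) //.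
by rewrite (card_uword_double _ ho) card_rword mulnA.
Qed.

End Counting.

(** * The theorem *)

Theorem theorem42 (X : finType) (n : nat) (hX : #|X| = n)
  (o : forall j : nat, uword X j -> rword X j)
  (ho : forall (j : nat) (u : uword X j), \pi_(uword X j) (o j u) = u)
  (k : nat) (hk : (2 <= k)%N) :
  let d : {additive M X k -> M X k.-1} := pleft o (k := k) \- pright o (k := k) in
  (im (@pi_map X k) =i equalizer (pleft o (k := k)) (pright o (k := k)) /\
   equalizer (pleft o (k := k)) (pright o (k := k)) =i ker d) /\
  ((2 <= n)%N ->
    (exists phi : {additive coker d -> 'Z_2}, bijective phi) /\
    exists r a b : nat,
      [/\ has_rank (im (@pi_map X k)) r, has_rank (ker d) r,
          has_rank (predT : {pred M X k}) a, has_rank (predT : {pred M X k.-1}) b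
        & r%:Z = a%:Z - b%:Z /\
          a%:Z - b%:Z = n%:Z * (2 * n%:Z - 2) * (2 * n%:Z - 1) ^+ (k - 2)]) /\
  exists p : Mtilde X k -> M X k.-1,
    [/\ forall m, p m = pleft o (val m), forall m, p m = pright o (val m)
      & forall z : ZC X, p (pi_tilde k z) = pi_map k.-1 z].
Proof.
case: k hk => [|[|k]] // _ d; set j := k.+1.
have im_eq : im (@pi_map X j.+1) =i
    equalizer (pleft o (k := j.+1)) (pright o (k := j.+1)).
  move=> m; apply/asboolP/eqP => [[z <-]|eq_m].
    by rewrite (pleft_pi_map ho) ?(pright_pi_map ho).
  by apply/asboolP; apply: (ker_sub_im ho); rewrite // eq_m subrr.
have eq_ker : equalizer (pleft o (k := j.+1)) (pright o (k := j.+1)) =i ker d.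
  by move=> m; rewrite -[LHS]/(pleft o m == pright o m) -subr_eq0.
split; first by [].
split.
  move=> n_gt1; have X_gt1 : (1 < #|X|)%N by rewrite hX.
  split; first exact: coker_pdiff.
  have ca := @card_uword X j o ho; have cb := @card_uword X k o ho.
  rewrite hX in ca cb.
  pose r := (n * (2 * n - 2) * (2 * n - 1) ^ k)%N.
  have rE : (r + #|{: uword X j}|)%N = #|{: uword X j.+1}|.
    rewrite ca cb /r expnS mulnA -mulnDl -[X in (_ + X)%N]muln1 -mulnDr addn1.
    by rewrite -subSn ?subSS // leq_pmulr // ltnW.
  have ker_rank : has_rank (ker d) r.
    apply: has_rank_ker => // u.
    exact: asboolW (double_generator_im ho (ltn0Sn k) X_gt1 u).
  exists r, #|{: uword X j.+1}|, #|{: uword X j}|; split=> //.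
  - by apply: eq_has_rank ker_rank => m; rewrite im_eq eq_ker.
  - exact: has_rank_freeg.
  - exact: has_rank_freeg.
(* The subtractions in r do not truncate because n is positive. *)
  rewrite -rE PoszD addrK; split=> //.
  rewrite /r -natz !natrM natrX !natrB ?natrM ?natz ?subn2 //.
    by rewrite muln_gt0 (ltnW n_gt1).
  exact: leq_pmulr (ltnW n_gt1).
exists (fun m => pleft o (val m)); split=> // [m|z].
  by apply/eqP; rewrite -[_ == _]/(val m \in equalizer _ _) -im_eq; exact: valP m.
exact: pleft_pi_map.
Qed.
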